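(* Let $A$ be a real $m\times n$ matrix with full column rank ($m\ge n$), let $b\in\mathbb{R}^m$, and let $x_*\in\mathbb{R}^n$ be a solution of the system $Ax=b$. Let $N$ be such that $64\,c\,m^2\log m\le N\le \exp(m/3)$ for some $c>3$. Let $\mathcal{S}=\{S^{(1)},\dots,S^{(N)}\}$ be a random set of $N$ independent $m\times s$ random matrices with i.i.d. standard normal entries. Then, with probability at least $1-1.1\,m^{3-c}$ (over the choice of $\mathcal{S}$), for any initial estimate $x_0\in\mathbb{R}^n$, the finite block Gaussian Kaczmarz method with collection $\mathcal{S}$ produces a sequence of iterates $\{x_k,\ k\ge 0\}$ that satisfies $$\mathbb{E}\|x_k-x_*\|_2^2\le\left(1-\frac{s}{36\,m\,\kappa^2(A)}\right)^k\|x_0-x_*\|_2^2 .$$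
   Context: $\sigma_{\min}(A),\sigma_{\max}(A)$ are the smallest and largest singular values of $A$ and $\kappa^2(A)=\sigma_{\max}^2(A)/\sigma_{\min}^2(A)$. $\log$ is the natural logarithm. The block size $s$ is a positive integer. $M^\dagger$ denotes the Moore-Penrose inverse of a matrix $M$. Finite block Gaussian Kaczmarz method with collection $\mathcal{S}$: starting from $x_0\in\mathbb{R}^n$, at each iteration a matrix $S$ is chosen uniformly at random from $\mathcal{S}$, with replacement (i.e. independently of the choices at previous iterations), and $$x_{k+1}=\bigl(\mathrm{Id}-(S^TA)^\dagger S^TA\bigr)x_k+(S^TA)^\dagger S^Tb .$$ For a given $\mathcal{S}$, the expectation $\mathbb{E}$ is over the random choices of the matrices from $\mathcal{S}$ during the iterations.
   Formalization: The formal theorem additionally assumes 1 - s/(36 m κ²(A)) ≥ 0; for larger s the English claim fails, since almost surely x_1 = x_* gives expected error 0 while the right-hand side is negative at k = 1 whenever x_0 ≠ x_*. *)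

(* Defs.v *)
From HB Require Import structures.
From mathcomp Require Import all_boot all_order all_algebra finmap.
From mathcomp Require Import all_classical all_reals all_analysis.

Set Implicit Arguments.
Unset Strict Implicit.
Unset Printing Implicit Defensive.

Import Order.TTheory GRing.Theory Num.Theory.
Local Open Scope classical_set_scope.
Local Open Scope ring_scope.

(* The norm that the library puts on matrices is the max norm, hence the
   explicit Euclidean norm. *)
Definition norm2 (R : realType) (n : nat) (x : 'cV[R]_n) : R :=
  Num.sqrt (\sum_i x i 0 ^+ 2).

Definition is_singular_value (R : realType) (m n : nat) (A : 'M[R]_(m, n))
    (sg : R) : Prop :=
  0 <= sg /\
  exists (u : 'cV[R]_m) (v : 'cV[R]_n),
    [/\ norm2 u = 1, norm2 v = 1, A *m v = sg *: u & A^T *m u = sg *: v].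

(* The set of singular values is finite, and nonempty when 0 < m and 0 < n, so
   this sup and this inf are then a maximum and a minimum. *)
Definition sigma_max (R : realType) (m n : nat) (A : 'M[R]_(m, n)) : R :=
  sup [set sg | is_singular_value A sg].

Definition sigma_min (R : realType) (m n : nat) (A : 'M[R]_(m, n)) : R :=
  inf [set sg | is_singular_value A sg].

Definition kappa2 (R : realType) (m n : nat) (A : 'M[R]_(m, n)) : R :=
  sigma_max A ^+ 2 / sigma_min A ^+ 2.

Definition is_pinv (R : realType) (m n : nat) (M : 'M[R]_(m, n))
    (X : 'M[R]_(n, m)) : Prop :=
  [/\ M *m X *m M = M, X *m M *m X = X,
      (M *m X)^T = M *m X & (X *m M)^T = X *m M].

(* The default value 0 is never used except when it is the answer: see
   [pinvP] and [is_pinv_uniq]. *)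
Definition pinv (R : realType) (m n : nat) (M : 'M[R]_(m, n)) :
    'M[R]_(n, m) := xget 0 [set X | is_pinv M X].

Lemma is_pinv_uniq (R : realType) (m n : nat) (M : 'M[R]_(m, n))
  (X Y : 'M[R]_(n, m)) : is_pinv M X -> is_pinv M Y -> X = Y.
Proof.
move=> [X1 X2 X3 X4] [Y1 Y2 Y3 Y4].
have eMX : M *m X = M *m Y.
  by rewrite -Y3 -{2}X1 -(mulmxA (M *m X)) trmx_mul X3 Y3 mulmxA Y1.
have eXM : X *m M = Y *m M.
  by rewrite -Y4 -{2}X1 -mulmxA mulmxA trmx_mul X4 Y4 -mulmxA (mulmxA M) Y1.
by rewrite -X2 eXM -mulmxA eMX mulmxA Y2.
Qed.

Lemma mulmx_tr_eq0 (R : realType) (n p : nat) (B : 'M[R]_(n, p)) :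
  B *m B^T = 0 -> B = 0.
Proof.
move=> B0; apply/matrixP => i j; rewrite mxE.
have /eqP : (B *m B^T) i i = 0 by rewrite B0 mxE.
rewrite mxE psumr_eq0; last by move=> k _; rewrite mxE -expr2 sqr_ge0.
by move=> /allP/(_ j (mem_index_enum j)); rewrite mxE -expr2 sqrf_eq0 => /eqP.
Qed.

Lemma row_free_gram_unit (R : realType) (r n : nat) (B : 'M[R]_(r, n)) :
  row_free B -> B *m B^T \in unitmx.
Proof.
move=> fB; rewrite -row_free_unit -kermx_eq0; apply/eqP.
have k0 : kermx (B *m B^T) *m B = 0.
  by apply: mulmx_tr_eq0; rewrite trmx_mul mulmxA -(mulmxA _ B) mulmx_ker mul0mx.
by apply: (row_free_inj fB); rewrite k0 mul0mx.
Qed.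

Lemma pinvP (R : realType) (m n : nat) (M : 'M[R]_(m, n)) :
  is_pinv M (pinv M).
Proof.
rewrite /pinv; apply: (@xgetPex _ 0 [set X | is_pinv M X]).
have [r [C [F [fC fF ->]]]] : exists r (C : 'M[R]_(m, r)) (F : 'M[R]_(r, n)),
    [/\ row_full C, row_free F & M = C *m F].
  exists (\rank M), (col_base M), (row_base M).
  by rewrite mulmx_base col_base_full row_base_free.
have uF : F *m F^T \in unitmx by exact: row_free_gram_unit.
have uC : C^T *m C \in unitmx.
  rewrite -{2}(trmxK C); apply: row_free_gram_unit.
  by rewrite -row_leq_rank mxrank_tr col_leq_rank.
have tF : (invmx (F *m F^T))^T = invmx (F *m F^T).
  by rewrite trmx_inv trmx_mul trmxK.
have tC : (invmx (C^T *m C))^T = invmx (C^T *m C).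
  by rewrite trmx_inv trmx_mul trmxK.
pose X := F^T *m invmx (F *m F^T) *m (invmx (C^T *m C) *m C^T).
have MX : C *m F *m X = C *m invmx (C^T *m C) *m C^T.
  by rewrite /X -!mulmxA (mulmxA F) (mulmxA (F *m F^T)) mulmxV // mul1mx.
have XM : X *m (C *m F) = F^T *m invmx (F *m F^T) *m F.
  by rewrite /X -!mulmxA (mulmxA C^T) (mulmxA (invmx (C^T *m C))) mulVmx //
             mul1mx.
exists X; split.
- by rewrite MX -!mulmxA (mulmxA C^T) (mulmxA (invmx _)) mulVmx // mul1mx.
- rewrite XM /X -!mulmxA (mulmxA F) (mulmxA (F *m F^T)) mulmxV //.
  by rewrite mul1mx.
- by rewrite MX !trmx_mul tC trmxK mulmxA.
- by rewrite XM !trmx_mul tF trmxK mulmxA.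
Qed.

Definition independent_classes d (T : measurableType d) (R : realType)
    (P : probability T R) (I : choiceType) (F : I -> set (set T)) : Prop :=
  forall (J : {fset I}) (E : I -> set T),
    (forall i, i \in J -> F i (E i)) ->
    P (\bigcap_(i in [set` J]) E i) = (\prod_(i <- J) P (E i))%E.

Definition sigma_rv d d' (T : measurableType d) (U : measurableType d')
    (X : T -> U) : set (set T) :=
  preimage_set_system setT X measurable.

Definition sigma_mx d (T : measurableType d) (R : realType) (m s : nat)
    (X : T -> 'M[R]_(m, s)) : set (set T) :=
  <<s \bigcup_(pq in [set: 'I_m * 'I_s])
        sigma_rv (fun w => X w pq.1 pq.2) >>.

Definition is_std_normal d (T : measurableType d) (R : realType)
    (P : probability T R) (X : T -> R) : Prop :=
  measurable_fun setT X /\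
  forall B : set R, measurable B -> P (X @^-1` B) = normal_prob 0 1 B.

Definition is_std_gaussian_mx d (T : measurableType d) (R : realType)
    (P : probability T R) (m s : nat) (X : T -> 'M[R]_(m, s)) : Prop :=
  (forall p q, is_std_normal P (fun w => X w p q)) /\
  independent_classes P
    (fun pq : 'I_m * 'I_s => sigma_rv (fun w => X w pq.1 pq.2)).

(* [S i] is the i-th matrix of the random collection. *)
Definition is_gaussian_collection d (T : measurableType d) (R : realType)
    (P : probability T R) (N m s : nat) (S : 'I_N -> T -> 'M[R]_(m, s)) : Prop :=
  (forall i, is_std_gaussian_mx P (S i)) /\
  independent_classes P (fun i => sigma_mx (S i)).

(* [idx k] is the index in the collection of the matrix chosen at iteration k;
   ['I_N] carries the discrete sigma-algebra. *)
Definition is_uniform_choice d (T : measurableType d) (R : realType)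
    (P : probability T R) (N : nat) (idx : nat -> T -> 'I_N) : Prop :=
  [/\ forall k B, measurable (idx k @^-1` B),
      forall k i, P (idx k @^-1` [set i]) = (N%:R^-1)%:E &
      independent_classes P
        (fun k => [set idx k @^-1` B | B in [set: set 'I_N]])].

(* [Sk k] is the matrix used to pass from the k-th to the (k+1)-th iterate. *)
Fixpoint block_kaczmarz (R : realType) (m n s : nat) (A : 'M[R]_(m, n))
    (b : 'cV[R]_m) (Sk : nat -> 'M[R]_(m, s)) (x0 : 'cV[R]_n) (k : nat) :
    'cV[R]_n :=
  if k is j.+1 then
    let M := (Sk j)^T *m A in
    (1%:M - pinv M *m M) *m block_kaczmarz A b Sk x0 j
      + pinv M *m ((Sk j)^T *m b)
  else x0.

(* Main.v *)
Require Import Defs.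
From HB Require Import structures.
From mathcomp Require Import all_boot all_order all_algebra finmap.
From mathcomp Require Import fingroup perm.
From mathcomp Require Import all_classical all_reals all_analysis.
From mathcomp Require Import measurable_realfun ring lra zify.

Set Implicit Arguments.
Unset Strict Implicit.
Unset Printing Implicit Defensive.

Import Order.TTheory GRing.Theory Num.Theory.
Import numFieldNormedType.Exports.
Local Open Scope classical_set_scope.
Local Open Scope ring_scope.

(** The error [e_k = x_k - x_*] satisfies [e_(k+1) = (Id - P_i) e_k], where
    [P_i] is the orthogonal projector onto the row space of [S_i^T A] and [i] is
    the index drawn at step [k].  Averaging over [i], everything reduces to the
    deterministic inequality
      [sum_i |P_i e|^2 >= N (s / (36 m kappa^2)) |e|^2  for every e],
    which has to hold outside a small event.

    Condition number.  Let [Q_i] be the orthogonal projector onto the range of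
    [S_i].  Since [S_i^T A e = S_i^T A P_i e], also [Q_i A e = Q_i A P_i e],
    hence [|Q_i A e| <= sigma_max |P_i e|] ([range_proj_le_pinv]).  As
    [|A e| >= sigma_min |e|], it suffices to show
    [sum_i |Q_i y|^2 >= N (s / (36 m)) |y|^2] for all [y], a statement about
    Gaussian matrices alone ([mean_contraction]).

    Mean.  Assume [s <= m].  The law of [S_i] is invariant under permutations
    and sign changes of the rows, so the mean of [Q_i] commutes with all signed
    permutation matrices and is a multiple of the identity; its trace is [s],
    because a Gaussian matrix has full column rank almost surely.  Therefore
    [E |Q_i y|^2 = (s / m) |y|^2] ([mean_range_proj]).

    Concentration.  For a fixed [y] the variables [|Q_i y|^2 / |y|^2] are
    independent with values in [[0, 1]], and a Chernoff bound shows that their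
    sum is below a quarter of its mean with probability at most
    [exp (- N s / (4 m))] ([chernoff_lower], [range_proj_lower_tail]).  A union
    bound over a grid of mesh [1 / (8 m)] in the cube [[-1, 1]^m] costs a factor
    [(16 m + 1)^m], which the hypothesis [N >= 64 c m^2 ln m] absorbs
    ([grid_union_small]).  All [Q_i] have norm at most one, so the bound passes
    from the grid to the whole sphere ([grid_lower_bound]).

    If [s > m] then almost surely all [S_i^T] are injective, every [P_i] is the
    identity, and the iteration reaches [x_*] after one step. *)

(** * Euclidean norms *)

Definition sqnorm (R : realType) (n : nat) (x : 'cV[R]_n) : R :=
  \sum_i x i 0 ^+ 2.

Definition dotv (R : realType) (n : nat) (x y : 'cV[R]_n) : R :=
  (x^T *m y) 0 0.

Section Norms.
Variable R : realType.
Implicit Types n m : nat.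

Lemma sqnorm_ge0 n (x : 'cV[R]_n) : 0 <= sqnorm x.
Proof. by apply: sumr_ge0 => i _; exact: sqr_ge0. Qed.

Lemma norm2_sqr n (x : 'cV[R]_n) : norm2 x ^+ 2 = sqnorm x.
Proof. by rewrite sqr_sqrtr// sqnorm_ge0. Qed.

Lemma dotvv n (x : 'cV[R]_n) : dotv x x = sqnorm x.
Proof. by rewrite /dotv mxE; apply: eq_bigr => i _; rewrite mxE expr2. Qed.

Lemma dotvC n (x y : 'cV[R]_n) : dotv x y = dotv y x.
Proof.
by rewrite /dotv !mxE; apply: eq_bigr => i _; rewrite !mxE mulrC.
Qed.

Lemma dotvDr n (x y z : 'cV[R]_n) : dotv x (y + z) = dotv x y + dotv x z.
Proof. by rewrite /dotv mulmxDr mxE. Qed.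

Lemma dotvZr n (x y : 'cV[R]_n) a : dotv x (a *: y) = a * dotv x y.
Proof. by rewrite /dotv -scalemxAr mxE. Qed.

Lemma dotvBr n (x y z : 'cV[R]_n) : dotv x (y - z) = dotv x y - dotv x z.
Proof. by rewrite dotvDr -scaleN1r dotvZr mulN1r. Qed.

Lemma dotvDl n (x y z : 'cV[R]_n) : dotv (y + z) x = dotv y x + dotv z x.
Proof. by rewrite ![dotv _ x]dotvC dotvDr. Qed.

Lemma dotvZl n (x y : 'cV[R]_n) a : dotv (a *: y) x = a * dotv y x.
Proof. by rewrite ![dotv _ x]dotvC dotvZr. Qed.

Lemma dotvMl m n (B : 'M[R]_(m, n)) x y : dotv (B *m x) y = dotv x (B^T *m y).
Proof. by rewrite /dotv trmx_mul mulmxA. Qed.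

Lemma sqnormZ n (x : 'cV[R]_n) a : sqnorm (a *: x) = a ^+ 2 * sqnorm x.
Proof. by rewrite -!dotvv dotvZl dotvZr mulrA expr2. Qed.

Lemma sqnormD n (x y : 'cV[R]_n) :
  sqnorm (x + y) = sqnorm x + dotv x y *+ 2 + sqnorm y.
Proof.
by rewrite -!dotvv dotvDl !dotvDr (dotvC y x) mulr2n !addrA.
Qed.

Lemma sqnorm_eq0 n (x : 'cV[R]_n) : (sqnorm x == 0) = (x == 0).
Proof.
apply/idP/eqP => [|->]; last by rewrite -dotvv /dotv mulmx0 mxE.
rewrite psumr_eq0; last by move=> i _; exact: sqr_ge0.
move=> /allP x0; apply/matrixP => i j; rewrite (ord1 j) mxE.
by have := x0 i (mem_index_enum i); rewrite sqrf_eq0 => /eqP.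
Qed.

Lemma sqnorm0 n : sqnorm (0 : 'cV[R]_n) = 0.
Proof. by apply/eqP; rewrite sqnorm_eq0. Qed.

Lemma sqnorm_gt0 n (x : 'cV[R]_n) : (0 < sqnorm x) = (x != 0).
Proof. by rewrite lt_neqAle eq_sym sqnorm_eq0 sqnorm_ge0 andbT. Qed.

Lemma dotv_projector n (Q : 'M[R]_n) x :
  Q^T = Q -> Q *m Q = Q -> dotv x (Q *m x) = sqnorm (Q *m x).
Proof. by move=> tQ QQ; rewrite -dotvv dotvMl tQ mulmxA QQ. Qed.

Lemma sqnorm_projectorC n (Q : 'M[R]_n) x :
  Q^T = Q -> Q *m Q = Q -> sqnorm (x - Q *m x) = sqnorm x - sqnorm (Q *m x).
Proof.
move=> tQ QQ; rewrite sqnormD -scaleN1r dotvZr sqnormZ dotv_projector//.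
by rewrite -addrA; congr (_ + _); ring.
Qed.

Lemma sqnorm_projector_le n (Q : 'M[R]_n) x :
  Q^T = Q -> Q *m Q = Q -> sqnorm (Q *m x) <= sqnorm x.
Proof.
move=> tQ QQ; rewrite -subr_ge0 -sqnorm_projectorC//; exact: sqnorm_ge0.
Qed.

End Norms.

(** * Extremal singular values *)

Section Rayleigh.
Variable R : realType.

Lemma continuous_sumr (T : topologicalType) (I : finType) (f : I -> T -> R) :
  (forall i, continuous (f i)) -> continuous (fun x => \sum_i f i x).
Proof.
move=> cf; apply: (@continuous_big _ _ (fun a b : R => a + b)).
  by move=> p; apply: add_continuous.
by move=> i _; exact: cf.
Qed.

(** The minimum of the quadratic form over the unit sphere exists by
    compactness; at a minimiser [c] the form [x^T (B - l) x] is nonnegative and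
    vanishes at [c], which forces [(B - l) c = 0]. *)
Lemma rayleigh_min n (B : 'M[R]_n.+1) : B^T = B ->
  exists v l, [/\ sqnorm v = 1, B *m v = l *: v &
    forall x, l * sqnorm x <= dotv x (B *m x)].
Proof.
move=> tB.
pose f (r : 'rV[R]_n.+1) : R := \sum_i \sum_j r 0 i * B i j * r 0 j.
pose g (r : 'rV[R]_n.+1) : R := \sum_i r 0 i ^+ 2.
have fE (x : 'cV[R]_n.+1) : f x^T = dotv x (B *m x).
  rewrite /f /dotv mxE; apply: eq_bigr => i _; rewrite !mxE mulr_sumr.
  by apply: eq_bigr => j _; rewrite !mxE mulrA.
have gE (x : 'cV[R]_n.+1) : g x^T = sqnorm x.
  by apply: eq_bigr => i _; rewrite !mxE.
have cf : continuous f.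
  apply: continuous_sumr => i; apply: continuous_sumr => j r.
  apply: (continuousM (s := fun x : 'rV[R]_n.+1 => x 0 i * B i j)).
    apply: (continuousM (s := fun x : 'rV[R]_n.+1 => x 0 i)).
      exact: coord_continuous.
    exact: cst_continuous.
  exact: coord_continuous.
have cg : continuous g.
  apply: continuous_sumr => i r.
  by apply: (continuousM (s := fun x : 'rV[R]_n.+1 => x 0 i));
     exact: coord_continuous.
pose K := [set r | g r = 1].
have K0 : K !=set0.
  exists (delta_mx 0 0); rewrite /K /= /g (bigD1 ord0)//= !mxE !eqxx expr1n.
  by rewrite big1 ?addr0// => i /negbTE i0; rewrite mxE i0 andbF expr0n.
have clK : closed K := preimage_closed (fun r _ => cg r) (@closed_eq R 1).
have bK : bounded_set K.
  exists 1; split; first exact: num_real.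
  move=> M M1 r /= gr; rewrite [leLHS]/Num.norm /= mx_normrE.
  apply/bigmax_leP; split; first by rewrite ltW// (lt_trans ltr01).
  move=> [i j] _ /=; rewrite (ord1 i) (le_trans _ (ltW M1))//.
  rewrite -(@expr_le1 _ 2)// real_normK ?num_real// -gr /g (bigD1 j)//= lerDl.
  by apply: sumr_ge0 => k _; exact: sqr_ge0.
have cK : compact K := bounded_closed_compact bK clK.
have [c cK1 cmin] := EVT_min_rV K0 cK (continuous_subspaceT cf).
rewrite inE /K /= in cK1.
pose v : 'cV[R]_n.+1 := c^T; pose l := f c.
have v1 : sqnorm v = 1 by rewrite -gE trmxK.
have q0 x : l * sqnorm x <= dotv x (B *m x).
  have [->|x0] := eqVneq x 0.
    by rewrite sqnorm0 mulr0 mulmx0 /dotv mulmx0 mxE.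
  have x1 : 0 < sqnorm x by rewrite sqnorm_gt0.
  pose a := (Num.sqrt (sqnorm x))^-1.
  have a2 : a ^+ 2 = (sqnorm x)^-1 by rewrite exprVn sqr_sqrtr// ltW.
  have := cmin (a *: x)^T; rewrite inE /K /= gE sqnormZ a2 mulVf ?gt_eqF//.
  move=> /(_ erefl); rewrite fE -scalemxAr dotvZl dotvZr mulrA -expr2 a2.
  by rewrite mulrC ler_pdivlMr.
exists v, l; split => //.
pose w := B *m v - l *: v.
suff w0 : w = 0 by apply/eqP; rewrite -subr_eq0 -/w w0.
apply/eqP; rewrite -sqnorm_eq0.
have qv : dotv v (B *m v) = l by rewrite -fE trmxK.
pose a := sqnorm w; pose b := dotv w (B *m w) - l * sqnorm w.
have wa : dotv w (B *m v) - l * dotv w v = a.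
  by rewrite /a -dotvv -[in RHS]/w {2}/w dotvBr dotvZr.
have key t : 0 <= t * a *+ 2 + t ^+ 2 * b.
  have := q0 (v + t *: w); rewrite -subr_ge0 sqnormD v1 sqnormZ mulmxDr.
  rewrite -scalemxAr !dotvDr !dotvDl !dotvZr !dotvZl qv.
  have -> : dotv v (B *m w) = dotv w (B *m v).
    by rewrite dotvC dotvMl tB.
  rewrite (dotvC v w); move/le_trans; apply; rewrite /b -wa.
  by rewrite le_eqVlt; apply/orP; left; apply/eqP; ring.
have b0 : 0 <= b by rewrite subr_ge0.
have a0 : 0 <= a by exact: sqnorm_ge0.
have b1 : 0 < b + 1 by lra.
have := key (- a / (b + 1)); have -> : - a / (b + 1) * a *+ 2 +
   (- a / (b + 1)) ^+ 2 * b = - (a / (b + 1)) ^+ 2 * (b + 2).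
  by field; rewrite gt_eqF.
rewrite mulNr oppr_ge0 pmulr_lle0; last by lra.
move=> h; have : (a / (b + 1)) ^+ 2 == 0.
  by rewrite eq_le h sqr_ge0.
by rewrite sqrf_eq0 mulf_eq0 invr_eq0 (gt_eqF b1) orbF.
Qed.

(** The left singular vector is [A v / sqrt l]. *)
Lemma singular_value_of_gram m n (A : 'M[R]_(m, n)) v l : 0 < l ->
  sqnorm v = 1 -> A^T *m A *m v = l *: v -> is_singular_value A (Num.sqrt l).
Proof.
move=> l0 v1 Av; have s0 : Num.sqrt l != 0 by rewrite gt_eqF// sqrtr_gt0.
split; first exact: sqrtr_ge0.
exists ((Num.sqrt l)^-1 *: (A *m v)), v; split.
- rewrite /norm2 -/(sqnorm _) sqnormZ -dotvv dotvMl mulmxA Av dotvZr dotvv v1.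
  by rewrite mulr1 exprVn sqr_sqrtr ?(ltW l0)// mulVf ?gt_eqF// sqrtr1.
- by rewrite /norm2 -/(sqnorm _) v1 sqrtr1.
- by rewrite scalerA divff// scale1r.
- rewrite -scalemxAr mulmxA Av scalerA; congr (_ *: _).
  by rewrite -{2}(sqr_sqrtr (ltW l0)) expr2 mulrA mulVf// mul1r.
Qed.

Lemma singular_value_sqr m n (A : 'M[R]_(m, n)) sg : is_singular_value A sg ->
  exists2 v, sqnorm v = 1 & sg ^+ 2 = sqnorm (A *m v).
Proof.
move=> [sg0 [u [v [u1 v1 Av _]]]]; exists v.
  by rewrite -norm2_sqr v1 expr1n.
by rewrite Av sqnormZ -norm2_sqr u1 expr1n mulr1.
Qed.

Lemma full_rank_sqnorm_gt0 m n (A : 'M[R]_(m, n)) (x : 'cV[R]_n) :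
  \rank A = n -> x != 0 -> 0 < sqnorm (A *m x).
Proof.
move=> rA; apply: contraTT; rewrite -leNgt => Ax.
have : sqnorm (A *m x) == 0 by rewrite eq_le Ax sqnorm_ge0.
rewrite sqnorm_eq0 -trmx_eq0 trmx_mul => /eqP Ax0.
have fA : row_free A^T by rewrite /row_free mxrank_tr rA.
by rewrite negbK -trmx_eq0; apply/eqP/(row_free_inj fA); rewrite mul0mx.
Qed.

Lemma gram_sym m n (A : 'M[R]_(m, n)) : (A^T *m A)^T = A^T *m A.
Proof. by rewrite trmx_mul trmxK. Qed.

Lemma dotv_gram m n (A : 'M[R]_(m, n)) (x : 'cV[R]_n) :
  dotv x (A^T *m A *m x) = sqnorm (A *m x).
Proof. by rewrite -dotvv dotvMl mulmxA. Qed.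

(** The norm of [A] is attained at an eigenvector of [A^T A], and the square
    root of the eigenvalue is a singular value; conversely every singular value
    is some [|A v|] with [|v| = 1], which makes the supremum finite. *)
Lemma sqnorm_mul_le m n (A : 'M[R]_(m, n)) (x : 'cV[R]_n) : \rank A = n ->
  sqnorm (A *m x) <= sigma_max A ^+ 2 * sqnorm x.
Proof.
case: n A x => [|n] A x rA.
  by rewrite (flatmx0 x) mulmx0 !sqnorm0 mulr0.
have tB : (- (A^T *m A))^T = - (A^T *m A) by rewrite linearN/= gram_sym.
have [v [l [v1 Bv lmin]]] := rayleigh_min tB.
have lmax y : sqnorm (A *m y) <= - l * sqnorm y.
  have := lmin y; rewrite mulNmx -dotv_gram -scaleN1r dotvZr.
  by rewrite mulN1r lerNr mulNr.
have Bv' : A^T *m A *m v = - l *: v.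
  by rewrite scaleNr -Bv mulNmx opprK.
have lE : sqnorm (A *m v) = - l by rewrite -dotv_gram Bv' dotvZr dotvv v1 mulr1.
have l0 : 0 < - l.
  rewrite -lE full_rank_sqnorm_gt0//; apply: contraPneq v1 => ->.
  by rewrite sqnorm0 => /esym/eqP; rewrite oner_eq0.
have sgl := singular_value_of_gram l0 v1 Bv'.
apply: le_trans (lmax x) _; rewrite ler_wpM2r ?sqnorm_ge0//.
have sub sg : is_singular_value A sg -> sg <= Num.sqrt (- l).
  move=> sv; have [w w1 sgE] := singular_value_sqr sv; case: sv => sg0 _.
  rewrite -ler_sqr ?nnegrE ?sqrtr_ge0// sqr_sqrtr ?(ltW l0)// sgE.
  by rewrite (le_trans (lmax w))// w1 mulr1.
have le_sup : Num.sqrt (- l) <= sigma_max A.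
  by apply: ub_le_sup => //; exists (Num.sqrt (- l)) => sg /sub.
rewrite -[leLHS](sqr_sqrtr (ltW l0)) ler_sqr// nnegrE ?sqrtr_ge0//.
exact: le_trans (sqrtr_ge0 _) le_sup.
Qed.

Lemma sqnorm_mul_ge m n (A : 'M[R]_(m, n)) (x : 'cV[R]_n) : \rank A = n ->
  sigma_min A ^+ 2 * sqnorm x <= sqnorm (A *m x).
Proof.
case: n A x => [|n] A x rA.
  by rewrite (flatmx0 x) mulmx0 !sqnorm0 mulr0.
have [v [l [v1 Bv lmin]]] := rayleigh_min (gram_sym A).
have lE : sqnorm (A *m v) = l by rewrite -dotv_gram Bv dotvZr dotvv v1 mulr1.
have l0 : 0 < l.
  rewrite -lE full_rank_sqnorm_gt0//; apply: contraPneq v1 => ->.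
  by rewrite sqnorm0 => /esym/eqP; rewrite oner_eq0.
rewrite -dotv_gram; apply: le_trans (lmin x).
rewrite ler_wpM2r ?sqnorm_ge0// -[leRHS](sqr_sqrtr (ltW l0)).
have lb0 : lbound [set sg | is_singular_value A sg] 0 by move=> sg [].
have sgl := singular_value_of_gram l0 v1 Bv.
rewrite ler_sqr ?nnegrE ?sqrtr_ge0//.
  by apply: ge_inf => //; exists 0.
by apply: lb_le_inf => //; exists (Num.sqrt l).
Qed.

End Rayleigh.

(** * The orthogonal projector onto the range of a matrix *)

(** When [S] has full column rank this is [S (S^T S)^-1 S^T]; otherwise the
    determinant vanishes and so does the matrix.  Writing the inverse with the
    adjugate makes every entry a rational function of the entries of [S], hence
    visibly measurable. *)
Definition range_proj (R : realType) (m r : nat) (S : 'M[R]_(m, r)) : 'M[R]_m :=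
  (\det (S^T *m S))^-1 *: (S *m \adj (S^T *m S) *m S^T).

Section RangeProj.
Variable R : realType.
Variables (m r : nat).
Implicit Types S : 'M[R]_(m, r).

Lemma range_proj_degenerate S : \det (S^T *m S) = 0 -> range_proj S = 0.
Proof. by move=> d0; rewrite /range_proj d0 invr0 scale0r. Qed.

Lemma range_projE S : \det (S^T *m S) != 0 ->
  range_proj S = S *m invmx (S^T *m S) *m S^T.
Proof.
move=> d0; rewrite /range_proj /invmx unitmxE unitfE d0.
by rewrite -scalemxAr -scalemxAl.
Qed.

Lemma range_proj_tr S : (range_proj S)^T = range_proj S.
Proof.
rewrite /range_proj linearZ/= !trmx_mul trmxK trmx_adj gram_sym.
by rewrite mulmxA.
Qed.

Lemma range_proj_idem S : range_proj S *m range_proj S = range_proj S.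
Proof.
have [d0|d0] := eqVneq (\det (S^T *m S)) 0.
  by rewrite range_proj_degenerate// mul0mx.
have uG : S^T *m S \in unitmx by rewrite unitmxE unitfE.
rewrite range_projE// -!mulmxA (mulmxA S^T) (mulmxA (S^T *m S)).
by rewrite mulmxV// mul1mx.
Qed.

Lemma trace_range_proj S :
  \tr (range_proj S) = if \det (S^T *m S) == 0 then 0 else r%:R.
Proof.
have [d0|d0] := eqVneq (\det (S^T *m S)) 0.
  by rewrite range_proj_degenerate// mxtrace0.
have uG : S^T *m S \in unitmx by rewrite unitmxE unitfE.
by rewrite range_projE// -mulmxA mxtrace_mulC -mulmxA mulVmx// mxtrace1.
Qed.

Lemma range_proj_orthogonal (D : 'M[R]_m) S : D^T *m D = 1%:M ->
  range_proj (D *m S) = D *m range_proj S *m D^T.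
Proof.
move=> DD; rewrite /range_proj trmx_mul -(mulmxA S^T) (mulmxA D^T) DD mul1mx.
by rewrite -scalemxAr -scalemxAl !mulmxA.
Qed.

(** The right-hand side is the quantity that controls one step of the
    iteration.  With [P] the projector onto the row space of [S^T A] and [Q] the
    projector onto the range of [S], [S^T A e = S^T A P e] gives
    [Q A e = Q A P e], so [|Q A e| <= |A| |P e|]. *)
Lemma range_proj_le_pinv n (A : 'M[R]_(m, n)) S (e : 'cV[R]_n) :
  \rank A = n ->
  sqnorm (range_proj S *m (A *m e)) <=
    sigma_max A ^+ 2 * sqnorm (Defs.pinv (S^T *m A) *m (S^T *m A) *m e).
Proof.
move=> rA; set M := S^T *m A; set P := Defs.pinv M *m M.
have [MM _ _ _] := pinvP M.
have QAP : range_proj S *m (A *m e) = range_proj S *m (A *m (P *m e)).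
  suff SP : S^T *m (A *m e) = S^T *m (A *m (P *m e)).
    by rewrite /range_proj -!scalemxAl -!(mulmxA _ S^T) SP.
  by rewrite !(mulmxA S^T) -/M (mulmxA M P) /P (mulmxA M) MM.
rewrite QAP (le_trans _ (sqnorm_mul_le _ rA))//.
by rewrite sqnorm_projector_le ?range_proj_tr ?range_proj_idem.
Qed.

End RangeProj.

Lemma pinv_proj_tr (R : realType) m n (M : 'M[R]_(m, n)) :
  (Defs.pinv M *m M)^T = Defs.pinv M *m M.
Proof. by have [] := pinvP M. Qed.

Lemma pinv_proj_idem (R : realType) m n (M : 'M[R]_(m, n)) :
  Defs.pinv M *m M *m (Defs.pinv M *m M) = Defs.pinv M *m M.
Proof. by have [_ XX _ _] := pinvP M; rewrite mulmxA XX. Qed.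

Lemma det_gram_neq0_submx (R : realType) (m r : nat) (S : 'M[R]_(m, r))
    (f : 'I_r -> 'I_m) :
  \det (rowsub f S) != 0 -> \det (S^T *m S) != 0.
Proof.
move=> d0; rewrite -unitfE -unitmxE -{2}(trmxK S); apply: row_free_gram_unit.
have u : rowsub f S \in unitmx by rewrite unitmxE unitfE.
rewrite -row_leq_rank mxrank_tr -{1}(mxrank_unit u).
by apply: mxrankS; apply/row_subP => i; rewrite row_rowsub row_sub.
Qed.

(** Once [S^T] is injective so is [S^T A], and the row space of [S^T A] is the
    whole space: the iteration stops after one step. *)
Lemma pinv_proj_full (R : realType) (m n s : nat) (A : 'M[R]_(m, n))
    (S : 'M[R]_(m, s)) (g : 'I_m -> 'I_s) : \rank A = n ->
  \det (colsub g S) != 0 -> Defs.pinv (S^T *m A) *m (S^T *m A) = 1%:M.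
Proof.
move=> rA d0.
have u : (colsub g S)^T \in unitmx by rewrite unitmx_tr unitmxE unitfE.
have fS : row_free S.
  rewrite -row_leq_rank -{1}(mxrank_unit u) mxrank_tr.
  have -> : colsub g S = S *m colsub g 1%:M.
    by rewrite -[in LHS](mulmx1 S) mulmx_colsub.
  exact: mxrankM_maxl.
set M := S^T *m A; have [MM _ _ _] := pinvP M.
have fM : row_free M^T.
  rewrite /M trmx_mul trmxK; apply/row_freeP.
  have /row_freeP[X SX] := fS.
  have /row_freeP[Y AY] : row_free A^T by rewrite /row_free mxrank_tr rA.
  by exists (X *m Y); rewrite mulmxA -(mulmxA A^T) SX mulmx1.
apply: trmx_inj; apply: (row_free_inj (A := M^T)) => //.
by rewrite trmx1 mul1mx -trmx_mul mulmxA MM.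
Qed.

(** * Measurability of matrix-valued maps *)

(** The measurable structure of [T] is a parameter because entries are tested
    both against the ambient sigma-algebra and against the sub-sigma-algebras
    that carry independence. *)
Definition measurable_mx d (T : measurableType d) (R : realType) (m n : nat)
    (X : T -> 'M[R]_(m, n)) : Prop :=
  forall i j, measurable_fun setT (fun w => X w i j).

Section MeasurableMx.
Context d (T : measurableType d) (R : realType).

Lemma measurable_fun_inv (f : T -> R) :
  measurable_fun setT f -> measurable_fun setT (fun w => (f w)^-1).
Proof.
move=> mf.
(* The real power function is measurable, but agrees with the inverse on
   nonnegative reals only; hence the square. *)
have -> : (fun w => (f w)^-1) = (fun w => f w * (f w ^+ 2) `^ (-1)).
  apply/funext => w; rewrite powR_inv1 ?sqr_ge0//.
  have [->|f0] := eqVneq (f w) 0; first by rewrite invr0 mul0r.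
  by rewrite expr2 invfM mulrA divff// mul1r.
apply: measurable_funM => //.
exact: (measurableT_comp (measurable_powR (-1)) (measurable_funX 2 mf)).
Qed.

Lemma measurable_mx_mul m n p (X : T -> 'M[R]_(m, n)) (Y : T -> 'M[R]_(n, p)) :
  measurable_mx X -> measurable_mx Y -> measurable_mx (fun w => X w *m Y w).
Proof.
move=> mX mY i j; under eq_fun do rewrite mxE.
by apply: measurable_sum => k; apply: measurable_funM; [exact: mX|exact: mY].
Qed.

Lemma measurable_mx_tr m n (X : T -> 'M[R]_(m, n)) :
  measurable_mx X -> measurable_mx (fun w => (X w)^T).
Proof. by move=> mX i j; under eq_fun do rewrite mxE; exact: mX. Qed.

Lemma measurable_mx_cst m n (A : 'M[R]_(m, n)) :
  measurable_mx (fun _ : T => A).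
Proof. by move=> i j; exact: measurable_cst. Qed.

Lemma measurable_mx_det n (X : T -> 'M[R]_n) :
  measurable_mx X -> measurable_fun setT (fun w => \det (X w)).
Proof.
move=> mX; apply: measurable_sum => s.
apply: measurable_funM => //; apply: measurable_prod => i _; exact: mX.
Qed.

Lemma measurable_mx_cofactor n (X : T -> 'M[R]_n) i j :
  measurable_mx X -> measurable_fun setT (fun w => cofactor (X w) i j).
Proof.
move=> mX; apply: measurable_funM => //; apply: measurable_mx_det => k l.
by under eq_fun do rewrite !mxE; exact: mX.
Qed.

Lemma measurable_range_proj m r (X : T -> 'M[R]_(m, r)) :
  measurable_mx X -> measurable_mx (fun w => range_proj (X w)).
Proof.
move=> mX i j; have mXt := measurable_mx_tr mX.
have mG := measurable_mx_mul mXt mX.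
under eq_fun do rewrite mxE; apply: measurable_funM.
  by apply: measurable_fun_inv; exact: measurable_mx_det.
apply: measurable_mx_mul => //; apply: measurable_mx_mul => // k l.
by under eq_fun do rewrite mxE; exact: measurable_mx_cofactor.
Qed.

Lemma measurable_dotv n (x y : T -> 'cV[R]_n) :
  measurable_mx x -> measurable_mx y ->
  measurable_fun setT (fun w => dotv (x w) (y w)).
Proof.
by move=> mx my; apply: measurable_mx_mul => //; exact: measurable_mx_tr.
Qed.

End MeasurableMx.

Lemma bounded_integrable d (T : measurableType d) (R : realType)
    (P : probability T R) (f : T -> R) (M : R) : measurable_fun setT f ->
  (forall w, `|f w| <= M) -> P.-integrable setT (EFin \o f).
Proof.
move=> mf fM; apply: measurable_bounded_integrable => //.
  by rewrite (le_lt_trans (probability_le1 P _)) ?ltry.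
exists M; split; first exact: num_real.
by move=> M' MM' w _ /=; rewrite (le_trans (fM w))// ltW.
Qed.

(** * Independence *)

Section Independence.
Context d (T : measurableType d) (R : realType) (P : probability T R).

(** The sets that factor against a fixed event form a lambda-system; the
    finite intersections of generators form a pi-system inside it. *)
Lemma independent_classes_group (I : choiceType) (F : I -> set (set T)) i0 E B :
  independent_classes P F ->
  (forall i, F i `<=` measurable) -> (forall i, setI_closed (F i)) ->
  F i0 E ->
  <<s \bigcup_(i in [set i | i != i0]) F i >> B ->
  P (E `&` B) = (P E * P B)%E.
Proof.
move=> indF mF FI FE.
pose G : set (set T) := [set B | exists (J : {fset I}) (C : I -> set T),
  [/\ i0 \notin J, forall i, i \in J -> F i (C i) &
      B = \bigcap_(i in [set` J]) C i]].
pose H : set (set T) := [set B | measurable B /\ P (E `&` B) = (P E * P B)%E].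
have mE : measurable E by apply: mF FE.
suff GH : <<s G >> `<=` H.
  move=> sB; apply: (proj2 (GH B _)); apply: sub_sigma_algebra2 sB.
  move=> C [i /= i0' FC]; exists [fset i]%fset, (fun=> C); split.
  - by rewrite inE eq_sym.
  - by move=> j; rewrite inE => /eqP ->.
  - by apply/seteqP; split=> [w Cw j _//|w /(_ i)]; apply; rewrite /= inE.
apply: lambda_system_subset => //.
- move=> _ _ [J [C [iJ FC ->]]] [J' [C' [iJ' FC' ->]]].
  exists (J `|` J')%fset, (fun i => (if i \in J then C i else setT) `&`
    (if i \in J' then C' i else setT)); split.
  + by rewrite inE negb_or iJ.
  + move=> i; rewrite inE; case: ifPn => iJ1; case: ifPn => iJ2 //= _.
    * by apply: FI; [exact: FC|exact: FC'].
    * by rewrite setIT; exact: FC.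
    * by rewrite setTI; exact: FC'.
  + apply/seteqP; split=> w.
      move=> [JC JC'] i /= _; split.
        by case: ifPn => // iJ1; exact: JC.
      by case: ifPn => // iJ1; exact: JC'.
    move=> h; split=> i /= iJ1; have := h i; rewrite /= inE iJ1 ?orbT/=.
      by case=> //.
    by case=> //.
- apply/dynkin_lambda_system; split.
  + by split => //; rewrite setIT probability_setT mule1.
  + move=> A [mA PA]; split; first exact: measurableC.
    rewrite -setDE measureD//; last first.
      by rewrite (le_lt_trans (probability_le1 P _)) ?ltry.
    have [a Ea] : exists a, P E = a%:E.
      by exists (fine (P E)); rewrite fineK// fin_num_measure.
    have [b Ab] : exists b, P A = b%:E.
      by exists (fine (P A)); rewrite fineK// fin_num_measure.
    move: PA; rewrite probability_setC// Ea Ab => PA.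
    transitivity (a%:E - a%:E * b%:E)%E.
      by congr (_ - _)%E; [exact: Ea|exact: PA].
    by rewrite -EFinM -!EFinB -EFinM mulrBr mulr1.
  + move=> A tA HA; split.
      by apply: bigcupT_measurable => n; have [] := HA n.
    rewrite setI_bigcupr measure_bigcup//=; last 2 first.
    - by move=> n _; apply: measurableI => //; have [] := HA n.
    - by apply: trivIset_setIl.
    rewrite measure_bigcup//=; last by move=> n _; have [] := HA n.
    have [a Ea] : exists a, P E = a%:E.
      by exists (fine (P E)); rewrite fineK// fin_num_measure.
    rewrite Ea -nneseriesZl//; apply: eq_eseriesr => n _.
    by rewrite -Ea; have [] := HA n.
- move=> _ [J [C [iJ FC ->]]]; split.
    by apply: fin_bigcap_measurable => // i /FC /mF.
  pose C' i := if i == i0 then E else C i.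
  have FC' i : i \in (i0 |` J)%fset -> F i (C' i).
    rewrite /C' !inE; case: eqP => [->//|_ /=]; exact: FC.
  have nJ i : i \in J -> i == i0 = false.
    by move=> iJ1; apply: contraNF iJ => /eqP <-.
  have := indF _ _ FC'; rewrite big_fsetU1//= {2}/C' eqxx => EC.
  transitivity (P (\bigcap_(i in [set` (i0 |` J)%fset]) C' i)).
    congr (P _); apply/seteqP; split=> w.
      move=> [Ew Cw] i /=; rewrite /C' !inE; case: eqP => //= _; exact: Cw.
    move=> h; split; first by have := h i0; rewrite /C' /= !inE eqxx; apply.
    by move=> i /= iJ1; have := h i; rewrite /C' /= !inE iJ1 orbT nJ//; apply.
  rewrite EC; congr (_ * _)%E.
  have -> : (\prod_(i <- J) P (C' i) = \prod_(i <- J) P (C i))%E.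
    by rewrite !big_seq; apply: eq_bigr => i iJ1; rewrite /C' nJ.
  by rewrite indF.
Qed.

End Independence.

(** * Gaussian matrices *)

Section Nonatomic.
Context d (T : measurableType d) (R : realType) (P : probability T R).

(** Under independence the pair [(Y, X)] follows the product law, and the
    sections of the diagonal are singletons, hence null. *)
Lemma independent_nonatomic_neq (X Y : T -> R) :
  measurable_fun setT X -> measurable_fun setT Y ->
  (forall A B, measurable A -> measurable B ->
    P (X @^-1` A `&` Y @^-1` B) = (P (X @^-1` A) * P (Y @^-1` B))%E) ->
  (forall x, P (X @^-1` [set x]) = 0%E) ->
  P [set w | X w = Y w] = 0%E.
Proof.
move=> mX mY ind na.
pose X' : {RV P >-> R} := HB.pack X (isMeasurableFun.Build _ _ _ _ X mX).
pose Y' : {RV P >-> R} := HB.pack Y (isMeasurableFun.Build _ _ _ _ Y mY).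
pose Z w := (Y w, X w).
have mZ : measurable_fun setT Z by exact: measurable_fun_pair.
pose Z' : {RV P >-> (R * R)%type} :=
  HB.pack Z (isMeasurableFun.Build _ _ _ _ Z mZ).
pose D : set (R * R) := [set p | p.1 - p.2 = 0].
have mD : measurable D.
  have mB : measurable_fun setT (fun p : R * R => p.1 - p.2).
    exact: (measurable_funB measurable_fst measurable_snd).
  by rewrite -[D]setTI; exact: (mB measurableT [set 0] (measurable_set1 0)).
have -> : [set w | X w = Y w] = Z @^-1` D.
  apply/seteqP; split=> w; rewrite /D /Z /=; first by move=> ->; rewrite subrr.
  by move/subr0_eq.
rewrite -[LHS]/(distribution P Z' D).
rewrite -(@product_measure_unique _ _ _ _ _ (distribution P Y')
  (distribution P X') (distribution P Z'))//.
  rewrite /product_measure1 integral0_eq// => x _ /=.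
  have -> : xsection D x = [set x].
    apply/seteqP; split=> y; rewrite /xsection /= inE /D /=.
      by move/subr0_eq.
    by move=> ->; rewrite subrr.
  exact: na.
by move=> A B mA mB; rewrite muleC -[RHS]ind// setIC.
Qed.

End Nonatomic.

Section NormalLaw.
Variable R : realType.

Lemma normal_prob_set1 (x : R) : normal_prob 0 1 [set x] = 0%E.
Proof.
by rewrite /normal_prob integral_set1.
Qed.

(** The density is even and Lebesgue measure is invariant under [x |-> - x]. *)
Lemma normal_prob_opp (B : set R) : measurable B ->
  normal_prob 0 1 ((-%R : R -> R) @^-1` B) = normal_prob 0 1 B :> \bar R.
Proof.
move=> mB; rewrite /normal_prob.
have mN : measurable_fun setT (-%R : R -> measurableTypeR R) by [].
transitivity (\int[pushforward lebesgue_measure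
    (-%R : R -> measurableTypeR R)]_(x in B) (normal_pdf 0 1 x)%:E)%E;
  last first.
  by apply: eq_measure_integral => A mA _; exact: lebesgue_measureN.
rewrite ge0_integral_pushforward//.
- apply: eq_integral => x _ /=; congr EFin.
  by rewrite !normal_pdfE ?oner_neq0// /normal_fun !subr0 sqrrN.
- by apply/measurable_EFinP/measurable_funTS; exact: measurable_normal_pdf.
- by move=> x _; rewrite lee_fin normal_pdf_ge0.
Qed.

End NormalLaw.

Section Transfer.
Context d (T : measurableType d) (R : realType) (P : probability T R).

(** Injectivity matters: two indices with the same image would require members
    of a single class to be independent of each other. *)
Lemma independent_classes_sub (I J : choiceType) (h : J -> I)
    (F : I -> set (set T)) (G : J -> set (set T)) :
  injective h -> (forall j, G j `<=` F (h j)) ->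
  independent_classes P F -> independent_classes P G.
Proof.
move=> hI GF indF K E GE.
pose E' i := \bigcap_(j in [set j | j \in K /\ h j = i]) E j.
have E'h j : j \in K -> E' (h j) = E j.
  move=> jK; apply/seteqP; split=> w.
    by move/(_ j); apply.
  by move=> Ew j' [_ /hI ->].
have FE i : i \in [fset h j | j in K]%fset -> F i (E' i).
  by move=> /imfsetP[j /= jK ->]; rewrite E'h//; exact/GF/GE.
have := indF _ _ FE; rewrite big_imfset/=; last by move=> ? ? _ _; exact: hI.
have -> : (\prod_(j <- K) P (E' (h j)) = \prod_(j <- K) P (E j))%E.
  by rewrite !big_seq; apply: eq_bigr => j jK; rewrite E'h.
move=> <-; congr (P _); apply/seteqP; split=> w Ew.
  by move=> i /= /imfsetP[j /= jK ->]; rewrite E'h//; exact: Ew.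
move=> j /= jK; rewrite -E'h//; apply: Ew => /=.
by apply/imfsetP; exists j.
Qed.

Lemma independent_classes_fin (I : finType) (F : I -> set (set T)) E :
  independent_classes P F -> (forall i, F i (E i)) ->
  P (\bigcap_i E i) = (\prod_i P (E i))%E.
Proof.
move=> indF FE.
transitivity (P (\bigcap_(i in [set` seq_fset tt (enum I)]) E i)).
  congr (P _); apply/seteqP; split=> w Ew i _; first exact: Ew.
  have iJ : i \in seq_fset tt (enum I) by rewrite seq_fsetE mem_enum.
  exact: Ew iJ.
rewrite indF// (perm_big _ (seq_fset_perm tt _)) undup_id ?enum_uniq//.
by rewrite big_enum.
Qed.

Lemma sigma_rv_comp (X : T -> R) (g : R -> R) : measurable_fun setT g ->
  sigma_rv (g \o X) `<=` sigma_rv X.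
Proof.
move=> mg _ [B mB <-]; exists (g @^-1` B) => //.
by rewrite -[X in measurable X]setTI; exact: mg.
Qed.

Lemma sigma_rv_measurable (X : T -> R) : measurable_fun setT X ->
  sigma_rv X `<=` measurable.
Proof. by move=> mX _ [B mB <-]; exact: mX. Qed.

Lemma sigma_rv_setI (X : T -> R) : setI_closed (sigma_rv X).
Proof.
move=> _ _ [A mA <-] [B mB <-]; exists (A `&` B); first exact: measurableI.
by rewrite preimage_setI !setTI.
Qed.

Lemma std_gaussian_measurable m s (X : T -> 'M[R]_(m, s)) :
  is_std_gaussian_mx P X -> measurable_mx X.
Proof. by move=> [gX _] i j; have [] := gX i j. Qed.

Lemma is_std_normal_sign (X : T -> R) (e : bool) :
  is_std_normal P X -> is_std_normal P (fun w => (-1) ^+ e * X w).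
Proof.
move=> [mX lX]; split; first exact: measurable_funM.
move=> B mB; case: e; last first.
  by rewrite -lX//; congr (P _); apply/funext => w /=; rewrite expr0 mul1r.
rewrite -normal_prob_opp// -lX.
  by congr (P _); apply/funext => w /=; rewrite expr1 mulN1r.
have mN : measurable_fun setT (-%R : R -> R) by [].
by rewrite -[X in measurable X]setTI; exact: mN.
Qed.

(** One statement for the minors and blocks used to prove nonsingularity and for
    the row permutations and sign changes used to compute the mean: the normal
    law is even, and injective reindexing preserves independence. *)
Lemma std_gaussian_reindex m s m' s' (X : T -> 'M[R]_(m, s))
    (f : 'I_m' -> 'I_m) (g : 'I_s' -> 'I_s) (e : 'I_m' -> bool) :
  injective f -> injective g -> is_std_gaussian_mx P X ->
  is_std_gaussian_mx P
    (fun w => \matrix_(i, j) ((-1) ^+ e i * X w (f i) (g j))).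
Proof.
move=> fI gI [nX iX].
have mE i j : (fun w => (\matrix_(i, j) ((-1) ^+ e i * X w (f i) (g j))) i j) =
    (fun w => (-1) ^+ e i * X w (f i) (g j)).
  by apply/funext => w; rewrite mxE.
split=> [i j|]; first by rewrite mE; exact: is_std_normal_sign.
apply: (independent_classes_sub
  (h := fun p : 'I_m' * 'I_s' => (f p.1, g p.2))) iX.
  by move=> [i j] [i' j'] /= [/fI -> /gI ->].
move=> [i j] /=; rewrite mE.
apply: (sigma_rv_comp (g := fun x => (-1) ^+ e i * x)).
exact: measurable_funM.
Qed.

End Transfer.

Section Nonsingular.
Context d (T : measurableType d) (R : realType) (P : probability T R).

(** Expanding along the first row, [det X = X_00 det X' + det Z] where [X'] and
    [Z] do not involve the entry [X_00].  By induction [det X' != 0] almost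
    surely, and then the determinant vanishes only when [X_00] meets the
    independent value [- det Z / det X']. *)
Lemma std_gaussian_det_neq0 k (X : T -> 'M[R]_k) :
  is_std_gaussian_mx P X -> P [set w | \det (X w) = 0] = 0%E.
Proof.
elim: k X => [|k IH] X gX.
  rewrite (_ : [set w | _] = set0) ?measure0//.
  by apply/seteqP; split=> w //=; rewrite det_mx00 => /eqP; rewrite oner_eq0.
pose o : 'I_k.+1 := ord0.
pose X' w := row' o (col' o (X w)).
have gX' : is_std_gaussian_mx P X'.
  have := std_gaussian_reindex (fun=> false) (@lift_inj k.+1 o)
    (@lift_inj k.+1 o) gX.
  congr (is_std_gaussian_mx P _); apply/funext => w; apply/matrixP => i j.
  by rewrite !mxE expr0 mul1r.
pose Z w := \matrix_(i, j) (if (i, j) == (o, o) then 0 else X w i j).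
have detE w : \det (X w) = X w o o * \det (X' w) + \det (Z w).
  have cofE j : cofactor (Z w) o j = cofactor (X w) o j.
    congr (_ * \det _); apply/matrixP => a b; rewrite !mxE xpair_eqE.
    by rewrite eq_sym (negbTE (neq_lift _ _)).
  rewrite (expand_det_row (X w) o) (expand_det_row (Z w) o).
  rewrite (bigD1 o)//= [X in _ = _ + X](bigD1 o)//=.
  have -> : Z w o o = 0 by rewrite mxE eqxx.
  rewrite mul0r add0r {1}/cofactor addn0 expr0 mul1r.
  congr (_ + _); apply: eq_bigr => j j0.
  by rewrite cofE mxE xpair_eqE (negbTE j0) andbF.
pose Y w := - \det (Z w) / \det (X' w).
have mX := std_gaussian_measurable gX; have mX' := std_gaussian_measurable gX'.
pose F (p : 'I_k.+1 * 'I_k.+1) := sigma_rv (fun w => X w p.1 p.2).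
pose T' := g_sigma_algebraType (\bigcup_(p in [set p | p != (o, o)]) F p).
have mXT' i j : (i, j) != (o, o) ->
    measurable_fun (setT : set T') (fun w => X w i j).
  move=> ij _ B mB; apply: sub_sigma_algebra; exists (i, j) => //.
  by exists B.
have mX'T' : @measurable_mx _ T' R _ _ X'.
  move=> i j; rewrite (_ : (fun w => _) = (fun w => X w (lift o i) (lift o j))).
    exact: mXT'.
  by apply/funext => w; rewrite !mxE.
have mZT' : @measurable_mx _ T' R _ _ Z.
  move=> i j; have [ij|ij] := eqVneq (i, j) (o, o).
    rewrite (_ : (fun w => _) = (fun=> 0)); first exact: measurable_cst.
    by apply/funext => w; rewrite mxE ij eqxx.
  rewrite (_ : (fun w => _) = (fun w => X w i j)); first exact: mXT'.
  by apply/funext => w; rewrite mxE (negbTE ij).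
have mYT' : measurable_fun (setT : set T') Y.
  apply: measurable_funM; last exact/measurable_fun_inv/measurable_mx_det.
  by apply: measurable_funN; exact: measurable_mx_det.
have FM p : F p `<=` measurable by exact: sigma_rv_measurable.
have mY : measurable_fun setT Y.
  have sub : <<s \bigcup_(p in [set p | p != (o, o)]) F p >> `<=` measurable.
    apply: smallest_sub; first exact: sigma_algebra_measurable.
    by move=> C [p _ /FM].
  by move=> _ B mB; exact: sub (mYT' measurableT B mB).
have PXY : P [set w | X w o o = Y w] = 0%E.
  apply: (independent_nonatomic_neq (mX o o) mY).
    move=> A B mA mB.
    apply: (independent_classes_group (F := F) (i0 := (o, o))) => //.
    - by have [] := gX.
    - by move=> p; exact: sigma_rv_setI.
    - by exists A => //; rewrite setTI.
    - by have := mYT' measurableT B mB; rewrite setTI.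
  by move=> x; have [_ lX] := gX.1 o o; rewrite lX// normal_prob_set1.
have PX' := IH _ gX'.
have mdX' : measurable [set w | \det (X' w) = 0].
  have := measurable_mx_det mX' measurableT (measurable_set1 0).
  by rewrite setTI.
have mXY : measurable [set w | X w o o = Y w].
  have mB := measurable_funB (mX o o) mY.
  have := mB measurableT [set 0] (measurable_set1 0); rewrite setTI.
  congr measurable; apply/seteqP; split=> w /=; first exact: subr0_eq.
  by move=> ->; rewrite subrr.
apply/eqP; rewrite eq_le measure_ge0 andbT.
have mdX : measurable [set w | \det (X w) = 0].
  have := measurable_mx_det mX measurableT (measurable_set1 0).
  by rewrite setTI.
have -> : (0 = P [set w | \det (X' w) = 0%R] + P [set w | X w o o = Y w])%E.
  by rewrite PX' PXY adde0.
apply: le_trans (measureU2 _ mdX' mXY); apply: le_measure; rewrite ?inE//.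
  exact: measurableU.
move=> w /=; rewrite detE.
have [->|d0] := eqVneq (\det (X' w)) 0; [by left|right].
apply: (mulIf d0); rewrite /Y divfK//; apply/eqP.
by rewrite -addr_eq0; apply/eqP.
Qed.

(** The square block formed by the first [r] rows is invertible almost surely,
    and this already forces full column rank. *)
Lemma std_gaussian_gram_neq0 m r (X : T -> 'M[R]_(m, r)) : (r <= m)%N ->
  is_std_gaussian_mx P X -> P [set w | \det ((X w)^T *m X w) = 0] = 0%E.
Proof.
move=> rm gX; have mX := std_gaussian_measurable gX.
pose f := widen_ord rm.
have fI : injective f by move=> i j /(congr1 val) /= /val_inj.
pose X' w := rowsub f (X w).
have gX' : is_std_gaussian_mx P X'.
  have := std_gaussian_reindex (fun=> false) fI (@inj_id 'I_r) gX.
  congr (is_std_gaussian_mx P _); apply/funext => w; apply/matrixP => i j.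
  by rewrite !mxE expr0 mul1r.
apply: subset_measure0 (std_gaussian_det_neq0 gX').
- have mG := measurable_mx_mul (measurable_mx_tr mX) mX.
  have := measurable_mx_det mG measurableT (measurable_set1 0).
  by rewrite setTI.
- have mX' := std_gaussian_measurable gX'.
  have := measurable_mx_det mX' measurableT (measurable_set1 0).
  by rewrite setTI.
- move=> w /= G0; apply/eqP; apply: contraPT G0 => /det_gram_neq0_submx.
  by move=> /eqP.
Qed.

End Nonsingular.

Section Law.
Context d (T : measurableType d) (R : realType) (P : probability T R).
Variables (m s : nat).

(** Boxes play the role of the measurable rectangles of the product
    sigma-algebra on the space of matrices. *)
Definition mx_box (B : 'I_m -> 'I_s -> set R) : set 'M[R]_(m, s) :=
  [set M | forall i j, B i j (M i j)].

Definition mx_boxes : set (set 'M[R]_(m, s)) :=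
  [set C | exists2 B, (forall i j, measurable (B i j)) & C = mx_box B].

Local Notation MT := (g_sigma_algebraType mx_boxes).

Lemma measurable_mx_id : @measurable_mx _ MT R _ _ id.
Proof.
move=> i j _ B mB; apply: sub_sigma_algebra.
exists (fun i' j' => if (i', j') == (i, j) then B else setT).
  by move=> i' j'; case: ifP.
apply/seteqP; split=> M /=.
  by move=> [_ MB] i' j'; case: eqP => // -[-> ->].
by move=> /(_ i j); rewrite eqxx.
Qed.

Lemma mx_box_preimage (X : T -> 'M[R]_(m, s)) B :
  X @^-1` mx_box B =
    \bigcap_(p : 'I_m * 'I_s) ((fun w => X w p.1 p.2) @^-1` B p.1 p.2).
Proof.
apply/seteqP; split=> w /=; first by move=> XB [i j] _ /=.
by move=> XB i j; exact: (XB (i, j)).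
Qed.

Lemma mx_box_prob (X : T -> 'M[R]_(m, s)) B : is_std_gaussian_mx P X ->
  (forall i j, measurable (B i j)) ->
  P (X @^-1` mx_box B) =
    (\prod_(p : 'I_m * 'I_s) normal_prob 0 1 (B p.1 p.2))%E.
Proof.
move=> [nX iX] mB; rewrite mx_box_preimage.
rewrite (independent_classes_fin iX).
  by apply: eq_bigr => p _; have [_ ->] := nX p.1 p.2.
by move=> p; exists (B p.1 p.2) => //; rewrite setTI.
Qed.

Lemma mx_boxes_setI : setI_closed mx_boxes.
Proof.
move=> _ _ [B mB ->] [B' mB' ->]; exists (fun i j => B i j `&` B' i j).
  by move=> i j; exact: measurableI.
apply/seteqP; split=> M /=; first by move=> [BM BM'] i j; split.
by move=> BM; split=> i j; have [] := BM i j.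
Qed.

Lemma mx_box_measurable_fun (X : T -> 'M[R]_(m, s)) :
  measurable_mx X -> measurable_fun setT (X : T -> MT).
Proof.
move=> mX; apply: (@measurability _ _ T MT setT X mx_boxes erefl).
move=> _ [_ [B mB ->] <-].
rewrite setTI mx_box_preimage; apply: fin_bigcap_measurable => // p _.
by rewrite -[X in measurable X]setTI; exact: mX.
Qed.

(** Boxes form a pi-system on which the law is prescribed, so the law of a
    standard Gaussian matrix is unique. *)
Lemma std_gaussian_law_unique (X X' : T -> 'M[R]_(m, s))
    (f : 'M[R]_(m, s) -> R) :
  is_std_gaussian_mx P X -> is_std_gaussian_mx P X' ->
  measurable_fun (setT : set MT) f -> (forall M, `|f M| <= 1) ->
  \int[P]_w f (X w) = \int[P]_w f (X' w).
Proof.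
move=> gX gX' mf fb.
have mX := mx_box_measurable_fun (std_gaussian_measurable gX).
have mX' := mx_box_measurable_fun (std_gaussian_measurable gX').
have intf (Y : T -> 'M[R]_(m, s)) (mY : measurable_fun setT (Y : T -> MT)) :
    P.-integrable setT (EFin \o (f \o Y)).
  apply: (bounded_integrable P (M := 1)) => [|w]; last exact: fb.
  exact: measurableT_comp mf mY.
rewrite /Rintegral; congr fine.
pose Y : {RV P >-> MT} :=
  HB.pack (X : T -> MT) (isMeasurableFun.Build _ _ T MT X mX).
pose Y' : {RV P >-> MT} :=
  HB.pack (X' : T -> MT) (isMeasurableFun.Build _ _ T MT X' mX').
have mEf : measurable_fun (setT : set MT) (EFin \o f) by exact/measurable_EFinP.
transitivity (\int[distribution P Y]_M (EFin \o f) M)%E.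
  by rewrite integral_distribution//; exact: intf.
transitivity (\int[distribution P Y']_M (EFin \o f) M)%E; last first.
  by rewrite integral_distribution//; exact: intf.
apply: eq_measure_integral => A mA _.
apply: (@measure_unique _ R MT mx_boxes (fun=> setT) erefl mx_boxes_setI _ _
  (distribution P Y) (distribution P Y')) => //.
- by move=> _; exists (fun _ _ => setT) => //; apply/seteqP; split.
- by rewrite bigcup_const.
- move=> _ [B mB ->].
  exact: etrans (mx_box_prob gX mB) (esym (mx_box_prob gX' mB)).
- by move=> _; rewrite (le_lt_trans (probability_le1 _ _)) ?ltry.
Qed.

End Law.

(** * The mean of the range projector *)

Section MeanProjector.
Context d (T : measurableType d) (R : realType) (P : probability T R).

Lemma Rintegral_sum (I : finType) (f : I -> T -> R) :
  (forall i, P.-integrable setT (EFin \o f i)) ->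
  \int[P]_w (\sum_i f i w) = \sum_i \int[P]_w f i w.
Proof.
move=> intf; rewrite /Rintegral.
under eq_integral do rewrite -sumEFin.
rewrite integral_sum// -sum_fine// => i _.
by apply: integrable_fin_num => //; exact: intf.
Qed.

Lemma orthogonal_projector_entry_le1 n (Q : 'M[R]_n) i j :
  Q^T = Q -> Q *m Q = Q -> `|Q i j| <= 1.
Proof.
move=> tQ QQ; rewrite -(@expr_le1 _ 2)// real_normK ?num_real//.
pose e : 'cV[R]_n := delta_mx j 0.
have e1 : sqnorm e = 1.
  rewrite /sqnorm (bigD1 j)//= big1 ?addr0; first by rewrite mxE !eqxx expr1n.
  by move=> k kj; rewrite mxE (negbTE kj) expr0n.
rewrite -e1; apply: le_trans (sqnorm_projector_le e tQ QQ).
rewrite /sqnorm (bigD1 i)//= -[X in X + _]/((Q *m e) i 0 ^+ 2).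
have -> : (Q *m e) i 0 = Q i j by rewrite -colE mxE.
by rewrite lerDl sumr_ge0// => k _; exact: sqr_ge0.
Qed.

Variables (m r : nat) (X : T -> 'M[R]_(m, r)).
Hypothesis gX : is_std_gaussian_mx P X.

Let Q w := range_proj (X w).

Let Q_le1 (M : 'M[R]_(m, r)) i j : `|range_proj M i j| <= 1.
Proof.
by apply: orthogonal_projector_entry_le1;
  rewrite ?range_proj_tr ?range_proj_idem.
Qed.

Let mQ : measurable_mx Q.
Proof. exact/measurable_range_proj/(std_gaussian_measurable gX). Qed.

Let intQ i j : P.-integrable setT (EFin \o (fun w => Q w i j)).
Proof. exact: (bounded_integrable P (mQ i j) (fun w => Q_le1 _ i j)). Qed.

Let q i j := \int[P]_w Q w i j.

Let q_signed_perm (f : {perm 'I_m}) (e : 'I_m -> bool) i j :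
  q i j = (-1) ^+ e i * (-1) ^+ e j * q (f i) (f j).
Proof.
pose X' w := \matrix_(i, j) ((-1) ^+ e i * X w (f i) j).
have gX' : is_std_gaussian_mx P X'.
  exact: (std_gaussian_reindex e (@perm_inj _ f) (@inj_id 'I_r) gX).
pose D : 'M[R]_m := \matrix_(i, j) ((-1) ^+ e i *+ (f i == j)).
have DM n (M : 'M[R]_(m, n)) i' j' :
    (D *m M) i' j' = (-1) ^+ e i' * M (f i') j'.
  rewrite mxE (bigD1 (f i'))//= mxE eqxx big1 ?addr0// => k kf.
  by rewrite mxE eq_sym (negbTE kf) mul0r.
have DD : D^T *m D = 1%:M.
  apply/mulmx1C/matrixP => i' j'; rewrite DM !mxE (inj_eq perm_inj) eq_sym.
  have [->|] := eqVneq; last by rewrite mulr0.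
  by rewrite mulr1n -expr2 sqrr_sign.
have QE w : range_proj (X' w) i j = (-1) ^+ e i * (-1) ^+ e j * Q w (f i) (f j).
  have -> : X' w = D *m X w by apply/matrixP => i' j'; rewrite DM mxE.
  rewrite range_proj_orthogonal// -mulmxA DM.
  have -> : Q w *m D^T = (D *m Q w)^T by rewrite trmx_mul range_proj_tr.
  have sQ : Q w (f j) (f i) = Q w (f i) (f j).
    by rewrite /Q -[in LHS]range_proj_tr mxE.
  by rewrite mxE DM mulrA sQ.
transitivity (\int[P]_w range_proj (X' w) i j).
  apply: (std_gaussian_law_unique (f := fun M => range_proj M i j) gX gX').
    exact: (measurable_range_proj (@measurable_mx_id R m r)).
  by move=> M; exact: Q_le1.
rewrite -RintegralZl//.
by apply: eq_Rintegral => w _; rewrite QE.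
Qed.

(** The law of the projector is invariant under conjugation by signed
    permutation matrices.  A sign change kills the off-diagonal entries of the
    mean, transpositions equate the diagonal ones, and the trace is the rank. *)
Lemma mean_range_proj y : (0 < m)%N -> (r <= m)%N ->
  \int[P]_w dotv y (range_proj (X w) *m y) = r%:R / m%:R * sqnorm y.
Proof.
move=> m0 rm.
have q_off i j : i != j -> q i j = 0.
  move=> ij; have := q_signed_perm 1%g (pred1 i) i j.
  rewrite !perm1 /= eqxx eq_sym (negbTE ij) expr1 expr0 mulr1 mulN1r => h; lra.
have q_diag i j : q i i = q j j.
  by rewrite (q_signed_perm (tperm i j) (fun=> false)) tpermL expr0 !mul1r.
have q_tr : \sum_i q i i = r%:R.
  rewrite -Rintegral_sum//; apply: EFin_inj.
  have mG := measurable_mx_mul (measurable_mx_tr (std_gaussian_measurable gX))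
    (std_gaussian_measurable gX).
  transitivity (\int[P]_w (r%:R : R)%:E)%E; last first.
    rewrite integral_cst// -[RHS]mule1; congr (_ * _)%E.
    exact: probability_setT.
  rewrite /Rintegral fineK; last first.
    apply: integrable_fin_num => //=; under eq_fun do rewrite -sumEFin.
    by apply: integrable_sum => // i _; exact: intQ.
  apply: ae_eq_integral => //.
  - by apply/measurable_EFinP; apply: measurable_sum => i; exact: mQ.
  - exists [set w | \det ((X w)^T *m X w) = 0]; split.
    + have := measurable_mx_det mG measurableT (measurable_set1 0).
      by rewrite setTI.
    + exact: std_gaussian_gram_neq0.
    + move=> w /= h; apply: contrapT => /eqP d0; apply: h => _.
      by rewrite -[X in X%:E](_ : \tr (Q w) = _)// trace_range_proj (negbTE d0).
have q_eq i : q i i = r%:R / m%:R.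
  have mR : m%:R != 0 :> R by rewrite pnatr_eq0 -lt0n.
  apply: (mulIf mR); rewrite divfK// -q_tr mulr_natr -[in LHS](card_ord m).
  by rewrite -sumr_const; apply: eq_bigr => j _; exact: q_diag.
have dotE w : dotv y (Q w *m y) = \sum_i \sum_j y i 0 * y j 0 * Q w i j.
  rewrite /dotv mxE; apply: eq_bigr => i _; rewrite !mxE mulr_sumr.
  by apply: eq_bigr => j _; rewrite mulrA mulrAC.
under eq_Rintegral do rewrite dotE.
have intyQ i j :
    P.-integrable setT (EFin \o (fun w => y i 0 * y j 0 * Q w i j)).
  apply: (bounded_integrable P (M := `|y i 0 * y j 0|)).
    by apply: measurable_funM => //; exact: mQ.
  by move=> w; rewrite normrM ler_piMr// Q_le1.
rewrite Rintegral_sum; last first.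
  move=> i; rewrite (_ : _ \o _ =
    fun w => (\sum_j (y i 0 * y j 0 * Q w i j)%:E)%E).
    by apply: integrable_sum => // j _; exact: intyQ.
  by apply/funext => w /=; rewrite sumEFin.
rewrite mulr_sumr; apply: eq_bigr => i _.
rewrite Rintegral_sum// (bigD1 i)//= big1 ?addr0.
  by rewrite RintegralZl// -/(q i i) q_eq mulrC expr2.
by move=> j ji; rewrite RintegralZl// -/(q i j) q_off ?mulr0// eq_sym.
Qed.

End MeanProjector.

(** * A lower-tail bound for independent sums *)

Section FiniteValued.
Context d (T : measurableType d) (R : realType) (P : probability T R).

Lemma integral_finite_valued (I : finType) (Z : T -> I) (g : I -> R) :
  (forall i, measurable (Z @^-1` [set i])) ->
  (\int[P]_w (g (Z w))%:E = (\sum_i g i * fine (P (Z @^-1` [set i])))%:E)%E.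
Proof.
move=> mZ.
have gE w : (g (Z w))%:E = (\sum_i (g i)%:E * (\1_(Z @^-1` [set i]) w)%:E)%E.
  rewrite (bigD1 (Z w))//= indicE mem_set//= mule1 big1 ?adde0// => i iZ.
  rewrite indicE memNset ?mule0//= => Zi; move: iZ; rewrite Zi eqxx//.
under eq_integral do rewrite gE.
have intI i : P.-integrable setT (fun w => (\1_(Z @^-1` [set i]) w)%:E).
  by apply: integrable_indic => //;
    rewrite (le_lt_trans (probability_le1 _ _)) ?ltry.
rewrite integral_sum//; last by move=> i; apply: integrableZl.
rewrite -sumEFin; apply: eq_bigr => i _.
by rewrite integralZl// integral_indic// setIT EFinM fineK// fin_num_measure.
Qed.

Lemma measurable_finite_valued (I : finType) (Z : T -> I) (g : I -> R) :
  (forall i, measurable (Z @^-1` [set i])) ->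
  measurable_fun setT (fun w => g (Z w)).
Proof.
move=> mZ _ B mB; rewrite setTI.
rewrite (_ : _ @^-1` _ = \bigcup_(i in [set i | B (g i)]) Z @^-1` [set i]).
  by apply: fin_bigcup_measurable.
by apply/seteqP; split=> w /=; [move=> BZ; exists (Z w)|move=> [i /= Bi ->]].
Qed.

Lemma probability_finite_valued (I : finType) (Z : T -> I) (p : pred I) :
  (forall i, measurable (Z @^-1` [set i])) ->
  measurable (Z @^-1` [set i | p i]) /\
  P (Z @^-1` [set i | p i]) = (\sum_(i | p i) fine (P (Z @^-1` [set i])))%:E.
Proof.
move=> mZ; have mp : measurable (Z @^-1` [set i | p i]).
  rewrite (_ : _ @^-1` _ = \bigcup_(i in [set` p]) Z @^-1` [set i]).
    by apply: fin_bigcup_measurable.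
  by apply/seteqP; split=> w /=; [move=> pZ; exists (Z w)|move=> [i /= pi ->]].
split=> //; transitivity (\int[P]_w (\1_(Z @^-1` [set i | p i]) w)%:E)%E.
  by rewrite integral_indic// setIT.
transitivity (\int[P]_w ((p (Z w))%:R)%:E)%E.
  apply: eq_integral => w _; rewrite indicE; congr ((nat_of_bool _)%:R%:E).
  by apply/idP/idP; rewrite inE.
rewrite (integral_finite_valued (fun i => (p i)%:R))//.
rewrite [in RHS]big_mkcond/=; congr (_%:E).
by apply: eq_bigr => i _; case: (p i); rewrite ?mul1r ?mul0r.
Qed.

End FiniteValued.

Section ChernoffDiscrete.
Context d (T : measurableType d) (R : realType) (P : probability T R).

(** With [1 + x <= exp x] the claim reduces to [1 <= (1 + x) (1 - x / 2)]. *)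
Lemma expRN_le_chord (x : R) : 0 <= x <= 1 -> expR (- x) <= 1 - x / 2.
Proof.
move=> /andP[x0 x1]; rewrite expRN.
have e1 : 1 + x <= expR x by exact: expR_ge1Dx.
have e0 : 0 < expR x := expR_gt0 x.
rewrite -[leLHS]mulr1 ler_pdivrMl//.
have : (1 + x) * (1 - x / 2) <= expR x * (1 - x / 2).
  by rewrite ler_wpM2r//; lra.
by apply: le_trans; nra.
Qed.

Variables (K : nat) (K0 : (0 < K)%N).

Let level (Y : T -> R) w : 'I_K.+1 := inord (Num.truncn (K%:R * Y w)).

Let levelE (Y : T -> R) w (v : 'I_K.+1) : 0 <= Y w <= 1 ->
  (level Y w == v) = (v%:R <= K%:R * Y w < v.+1%:R).
Proof.
move=> /andP[Y0 Y1]; have KR : 0 < K%:R :> R by rewrite ltr0n.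
have KY0 : 0 <= K%:R * Y w by rewrite mulr_ge0// ltW.
have lK : (Num.truncn (K%:R * Y w) < K.+1)%N.
  by rewrite ltnS truncn_le_nat -natr1 ltr_pwDr// ler_piMr// ltW.
rewrite -truncn_ge_nat// ltNge -truncn_ge_nat// -ltnNge ltnS -eqn_leq eq_sym.
by rewrite -val_eqE /= inordK.
Qed.

Let level_le (Y : T -> R) w : 0 <= Y w <= 1 ->
  (level Y w)%:R / K%:R <= Y w < (level Y w)%:R / K%:R + K%:R^-1.
Proof.
move=> Y01; have := levelE (level Y w) Y01; rewrite eqxx => /esym.
have KR : 0 < K%:R :> R by rewrite ltr0n.
rewrite ler_pdivrMr// (mulrC (Y w)) => /andP[-> h] /=.
by rewrite -[X in _ + X]mul1r -mulrDl natr1 ltr_pdivlMr// mulrC.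
Qed.

Let level_preimage (Y : T -> R) v : measurable_fun setT Y ->
  (forall w, 0 <= Y w <= 1) -> level Y @^-1` [set v] =
  Y @^-1` `[v%:R / K%:R, v.+1%:R / K%:R[.
Proof.
move=> mY Y01; have KR : 0 < K%:R :> R by rewrite ltr0n.
apply/seteqP; split=> w /=; rewrite in_itv/= ler_pdivrMr// ltr_pdivlMr//.
  by move=> lv; rewrite mulrC -levelE// lv.
by rewrite mulrC -levelE// => /eqP.
Qed.

(** The summands are rounded down to multiples of [1/K], so that the
    exponential moment of the sum is a finite sum of probabilities of
    intersections and independence can be used as it stands. *)
Lemma chernoff_lower_discrete N (F : 'I_N -> set (set T)) (Y : 'I_N -> T -> R)
    (mu t : R) :
  independent_classes P F ->
  (forall i, F i `<=` measurable) ->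
  (forall i B, measurable B -> F i (Y i @^-1` B)) ->
  (forall i w, 0 <= Y i w <= 1) ->
  (forall i, mu <= \int[P]_w Y i w) ->
  (P [set w | (\sum_i Y i w < t)%R] <=
    (expR (t - N%:R * ((mu - K%:R^-1) / 2)))%:E)%E.
Proof.
move=> indF mF FY Y01 muY; have KR : 0 < K%:R :> R by rewrite ltr0n.
have mY i : measurable_fun setT (Y i).
  by move=> _ B mB; rewrite setTI; apply/mF/FY.
pose L i := level (Y i).
have FL i v : F i (L i @^-1` [set v]) by rewrite level_preimage//; exact: FY.
pose p i v := fine (P (L i @^-1` [set v])).
have p0 i v : 0 <= p i v by rewrite fine_ge0.
have pE i v : P (L i @^-1` [set v]) = (p i v)%:E.
  by rewrite fineK// fin_num_measure//; exact: mF.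
have p1 i : \sum_v p i v = 1.
  apply: EFin_inj; transitivity (\int[P]_w (1 : R)%:E)%E; last first.
    by rewrite integral_cst// mul1e; exact: probability_setT.
  rewrite (integral_finite_valued P (fun=> 1) (fun v => mF i _ (FL i v))).
  by congr EFin; apply: eq_bigr => v _; rewrite mul1r.
have pmu i : mu - K%:R^-1 <= \sum_(v < K.+1) v%:R / K%:R * p i v.
  have -> : \sum_(v < K.+1) v%:R / K%:R * p i v =
      \sum_(v < K.+1) (v%:R / K%:R + K%:R^-1) * p i v - K%:R^-1.
    under [in RHS]eq_bigr do rewrite mulrDl.
    by rewrite big_split/= -mulr_sumr p1 mulr1 addrK.
  rewrite lerB// (le_trans (muY i))// -lee_fin.
  have intY : P.-integrable setT (EFin \o Y i).
    apply: (bounded_integrable P (M := 1) (mY i)) => w.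
    by have /andP[Y0 Y1] := Y01 i w; rewrite ger0_norm.
  rewrite -(integral_finite_valued P (fun v : 'I_K.+1 => v%:R / K%:R + K%:R^-1)
    (fun v => mF i _ (FL i v))).
  rewrite /Rintegral fineK; last exact: integrable_fin_num.
  apply: ge0_le_integral => //.
  - by move=> w _; rewrite lee_fin; have /andP[] := Y01 i w.
  - by apply/measurable_EFinP.
  - apply/measurable_EFinP.
    exact: (measurable_finite_valued (fun v : 'I_K.+1 => v%:R / K%:R + K%:R^-1)
      (fun v => mF i _ (FL i v))).
  - move=> w _; rewrite lee_fin ltW//; by have /andP[] := level_le (Y01 i w).
have moment i : \sum_(v < K.+1) expR (- (v%:R / K%:R)) * p i v <=
    expR (- ((mu - K%:R^-1) / 2)).
  apply: le_trans (_ : 1 - (\sum_(v < K.+1) v%:R / K%:R * p i v) / 2 <= _).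
    rewrite -[X in X - _](p1 i) mulr_suml -sumrB; apply: ler_sum => v _.

    have -> : p i v - v%:R / K%:R * p i v / 2 =
        (1 - v%:R / K%:R / 2) * p i v by ring.
    rewrite ler_wpM2r// expRN_le_chord//.
    by rewrite divr_ge0//= ler_pdivrMr// mul1r ler_nat -ltnS.
  apply: le_trans (expR_ge1Dx _); rewrite lerD2l lerN2 ler_pM2r//.
pose Z w : {ffun 'I_N -> 'I_K.+1} := [ffun i => L i w].
have ZE v : Z @^-1` [set v] = \bigcap_i (L i @^-1` [set v i]).
  apply/seteqP; split=> w /=; first by move=> <- i _; rewrite ffunE.
  by move=> Zv; apply/ffunP => i; rewrite ffunE; exact: Zv.
have mZ v : measurable (Z @^-1` [set v]).
  by rewrite ZE; apply: fin_bigcap_measurable => // i _; exact: mF.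
have PZ v : fine (P (Z @^-1` [set v])) = \prod_i p i (v i).
  rewrite ZE (independent_classes_fin indF)//.
  transitivity (fine (\prod_i (p i (v i))%:E)%E); last by rewrite prodEFin.
  by congr fine; apply: eq_bigr => i _; exact: pE.
pose c (v : {ffun 'I_N -> 'I_K.+1}) := \sum_i (v i)%:R / K%:R < t.
have [mc Pc] := probability_finite_valued P c mZ.
apply: (@le_trans _ _ (P (Z @^-1` [set v | c v]))).
  apply: le_measure; rewrite ?inE//.
    have mS := measurable_sum (index_enum _) mY.
    by have := mS measurableT `]-oo, t[%classic (measurable_itv _);
      rewrite setTI; congr measurable; apply/seteqP; split=> w /=;
      rewrite in_itv.
  move=> w /=; apply: le_lt_trans; apply: ler_sum => i _; rewrite ffunE.
  by have /andP[] := level_le (Y01 i w).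
rewrite Pc lee_fin; apply: (@le_trans _ _
  (\sum_(v | c v) expR (t - \sum_i (v i)%:R / K%:R) * \prod_i p i (v i))).
  apply: ler_sum => v cv; rewrite PZ ler_peMl ?prodr_ge0//.
  rewrite -[leLHS]expR0 ler_expR.
  by rewrite subr_ge0 ltW.
apply: (@le_trans _ _
  (\sum_(v : {ffun 'I_N -> 'I_K.+1})
     expR (t - \sum_i (v i)%:R / K%:R) * \prod_i p i (v i))).
  rewrite [leRHS](bigID c)/= lerDl; apply: sumr_ge0 => v _.
  by rewrite mulr_ge0 ?expR_ge0 ?prodr_ge0.
have -> : \sum_(v : {ffun 'I_N -> 'I_K.+1})
      expR (t - \sum_i (v i)%:R / K%:R) * \prod_i p i (v i) =
    expR t * \prod_i \sum_(v < K.+1) expR (- (v%:R / K%:R)) * p i v.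
  rewrite bigA_distr_bigA/= mulr_sumr; apply: eq_bigr => v _.
  by rewrite big_split/= expRD -sumrN expR_sum mulrA.
rewrite expRD ler_pM2l ?expR_gt0//.
apply: (@le_trans _ _ (\prod_(i < N) expR (- ((mu - K%:R^-1) / 2)))).
  apply: ler_prod => i _; rewrite moment andbT sumr_ge0// => v _.
  by rewrite mulr_ge0 ?expR_ge0.
by rewrite prodr_const card_ord -expRM_natl mulrN.
Qed.

End ChernoffDiscrete.

(** The limit [K -> oo] of the discretised bound. *)
Lemma chernoff_lower d (T : measurableType d) (R : realType)
    (P : probability T R) N (F : 'I_N -> set (set T)) (Y : 'I_N -> T -> R)
    (mu t : R) :
  independent_classes P F ->
  (forall i, F i `<=` measurable) ->
  (forall i B, measurable B -> F i (Y i @^-1` B)) ->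
  (forall i w, 0 <= Y i w <= 1) ->
  (forall i, mu <= \int[P]_w Y i w) ->
  (P [set w | (\sum_i Y i w < t)%R] <= (expR (t - N%:R * mu / 2))%:E)%E.
Proof.
move=> indF mF FY Y01 muY.
pose A := [set w | \sum_i Y i w < t]; pose p := fine (P A).
have mA : measurable A.
  have mY i : measurable_fun setT (Y i).
    by move=> _ B mB; rewrite setTI; apply/mF/FY.
  have mS := measurable_sum (index_enum _) mY.
  by have := mS measurableT `]-oo, t[%classic (measurable_itv _);
    rewrite setTI; congr measurable; apply/seteqP; split=> w /=; rewrite in_itv.
have pE : P A = p%:E by rewrite fineK// fin_num_measure.
rewrite -/A pE lee_fin.
have pK K : (0 < K)%N -> p <= expR (t - N%:R * ((mu - K%:R^-1) / 2)).
  move=> K0; rewrite -lee_fin -pE.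
  exact: (chernoff_lower_discrete K0 t indF).
rewrite leNgt; apply/negP => lt_p.
have p0 : 0 < p by apply: lt_trans lt_p; exact: expR_gt0.
have lt_ln : t - N%:R * mu / 2 < ln p by rewrite -ltr_expR lnK.
pose e := ln p - (t - N%:R * mu / 2); have e0 : 0 < e by rewrite subr_gt0.
pose K := (Num.bound (N%:R / e)).+1.
have KR : 0 < K%:R :> R by rewrite ltr0n.
have : N%:R / K%:R < e.
  rewrite ltr_pdivrMr// mulrC -ltr_pdivrMr//.
  by rewrite (lt_trans (archi_boundP _)) ?ltr_nat// divr_ge0// ltW.
have : ln p <= t - N%:R * ((mu - K%:R^-1) / 2) by rewrite -ler_expR lnK// pK.
have NK0 : 0 <= N%:R / K%:R :> R by rewrite divr_ge0// ltW.
rewrite mulrA mulrBr.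
rewrite /e; lra.
Qed.

(** * Discretising the unit sphere *)

Section Grid.
Variable R : realType.
Variables (m K : nat).
Hypothesis K0 : (0 < K)%N.

(** The coordinates run through the multiples of [1 / K] in [[-1, 1]]. *)
Definition grid_point (g : {ffun 'I_m -> 'I_(2 * K).+1}) : 'cV[R]_m :=
  \col_i ((g i)%:R / K%:R - 1).

(** Each coordinate is rounded down to a multiple of [1 / K]. *)
Lemma grid_approx (y : 'cV[R]_m) : sqnorm y = 1 ->
  exists g, sqnorm (grid_point g - y) <= m%:R / K%:R ^+ 2.
Proof.
move=> y1; have KR : 0 < K%:R :> R by rewrite ltr0n.
have y_le i : -1 <= y i 0 <= 1.
  rewrite -ler_norml -(@expr_le1 _ 2)// real_normK ?num_real// -y1.
  by rewrite /sqnorm (bigD1 i)//= lerDl sumr_ge0// => k _; exact: sqr_ge0.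
pose z i := K%:R * (y i 0 + 1).
have z0 i : 0 <= z i.
  by have /andP[yl _] := y_le i; rewrite mulr_ge0// ?(ltW KR)//; lra.
exists [ffun i => inord (Num.truncn (z i))].
have -> : m%:R / K%:R ^+ 2 = \sum_(i < m) (K%:R^-1 : R) ^+ 2.
  by rewrite sumr_const card_ord -exprVn mulr_natl.
apply: ler_sum => i _; rewrite !mxE ffunE inordK; last first.
  rewrite ltnS truncn_le_nat -natr1 natrM (le_lt_trans (_ : _ <= K%:R * 2))//.
    by rewrite ler_pM2l//; have /andP[] := y_le i; lra.
  by rewrite mulrC ltrDl.
have /andP[zl zu] := truncn_itv (z0 i).
rewrite -[leLHS]real_normK ?num_real//.
rewrite ler_sqr ?nnegrE ?invr_ge0 ?normr_ge0// ?(ltW KR)//.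
have -> : (Num.truncn (z i))%:R / K%:R - 1 - y i 0 =
    ((Num.truncn (z i))%:R - z i) / K%:R by rewrite /z; field; rewrite gt_eqF.
rewrite normrM [X in _ * X]gtr0_norm ?invr_gt0// ler_piMl ?invr_ge0 ?(ltW KR)//.
by rewrite distrC ger0_norm ?subr_ge0// lerBlDr addrC natr1 ltW.
Qed.

Lemma sqnormD_le n (x y : 'cV[R]_n) :
  sqnorm (x + y) <= 2 * sqnorm x + 2 * sqnorm y.
Proof.
have := sqnorm_ge0 (x - y); rewrite !sqnormD -scaleN1r dotvZr sqnormZ.
by rewrite sqrrN expr1n mul1r; lra.
Qed.

(** Lower bounds for a sum of orthogonal projectors pass from the grid to the
    sphere: replacing [y] by a grid point [u] costs a factor two in the
    quadratic forms and an additive error of the order of [|u - y|^2]. *)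
Lemma grid_lower_bound N (Q : 'I_N -> 'M[R]_m) (tau : R) :
  0 <= tau ->
  (forall i, (Q i)^T = Q i) -> (forall i, Q i *m Q i = Q i) ->
  (forall g,
    tau * sqnorm (grid_point g) <= \sum_i sqnorm (Q i *m grid_point g)) ->
  forall y, (tau * (1 / 2 - m%:R / K%:R ^+ 2) / 2 - N%:R * (m%:R / K%:R ^+ 2))
     * sqnorm y <= \sum_i sqnorm (Q i *m y).
Proof.
move=> tau0 tQ QQ lb.
set e := m%:R / K%:R ^+ 2.
suff unit_case y : sqnorm y = 1 ->
    tau * (1 / 2 - e) / 2 - N%:R * e <= \sum_i sqnorm (Q i *m y).
  move=> y; have [->|y0] := eqVneq y 0.
    by rewrite sqnorm0 mulr0 sumr_ge0// => i _; exact: sqnorm_ge0.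
  have y1 : 0 < sqnorm y by rewrite sqnorm_gt0.
  pose a := (Num.sqrt (sqnorm y))^-1.
  have a2 : a ^+ 2 = (sqnorm y)^-1 by rewrite exprVn sqr_sqrtr// ltW.
  have := unit_case (a *: y); rewrite sqnormZ a2 mulVf ?gt_eqF// => /(_ erefl).
  rewrite (eq_bigr (fun i => (sqnorm y)^-1 * sqnorm (Q i *m y))); last first.
    by move=> i _; rewrite -scalemxAr sqnormZ a2.
  by rewrite -mulr_sumr ler_pdivlMl// mulrC.
move=> y1; have [g ge] := grid_approx y1; set u := grid_point g in ge.
have hu : 1 / 2 - e <= sqnorm u.
  have := sqnormD_le u (y - u); rewrite addrC subrK y1.
  have -> : sqnorm (y - u) = sqnorm (u - y).
    by rewrite -[y - u]opprB -scaleN1r sqnormZ sqrrN expr1n mul1r.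
  move: ge; rewrite -/e; lra.
have hs : \sum_i sqnorm (Q i *m u) <=
    2 * (\sum_i sqnorm (Q i *m y)) + 2 * (N%:R * e).
  have -> : 2 * (N%:R * e) = \sum_(i < N) 2 * e.
    by rewrite sumr_const card_ord [LHS]mulrCA -[RHS]mulr_natl.
  rewrite mulr_sumr -big_split/=; apply: ler_sum => i _.
  have -> : Q i *m u = Q i *m y + Q i *m (u - y).
    by rewrite -mulmxDr addrC subrK.
  apply: le_trans (sqnormD_le _ _) _; rewrite lerD2l ler_pM2l//.
  exact: le_trans (sqnorm_projector_le _ _ _) ge.
have := lb g; rewrite -/u.
have : tau * (1 / 2 - e) <= tau * sqnorm u by rewrite ler_wpM2l.
lra.
Qed.

End Grid.

(** * The mean error of the iteration for a fixed collection *)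

Section MeanError.
Variable R : realType.

Lemma big_tuple_cons (I : finType) k (F : k.+1.-tuple I -> R) :
  \sum_t F t = \sum_i \sum_(t : k.-tuple I) F (cons_tuple i t).
Proof.
rewrite pair_big/= (reindex (fun p : I * k.-tuple I => cons_tuple p.1 p.2))//=.
exists (fun t => (thead t, behead_tuple t)) => [[i t]|t] _ /=.
  by rewrite theadE; congr pair; apply: val_inj.
by rewrite [RHS]tuple_eta; apply: val_inj.
Qed.

Variables (m n s N : nat) (A : 'M[R]_(m, n)) (b : 'cV[R]_m) (xs : 'cV[R]_n).
Hypothesis hxs : A *m xs = b.
Variable S : 'I_N -> 'M[R]_(m, s).

Definition row_proj i := Defs.pinv ((S i)^T *m A) *m ((S i)^T *m A).

(** Peeling off the first step rather than the last one matches the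
    decomposition of a tuple of indices into its head and its tail. *)
Lemma block_kaczmarz_front (J : nat -> 'I_N) x0 k :
  block_kaczmarz A b (S \o J) x0 k.+1 =
  block_kaczmarz A b (S \o (J \o succn)) (block_kaczmarz A b (S \o J) x0 1) k.
Proof.
by elim: k => // k IH; rewrite [LHS]/= -/(block_kaczmarz _ _ _ _ k.+1) IH.
Qed.

Lemma block_kaczmarz_error (J : nat -> 'I_N) x0 :
  block_kaczmarz A b (S \o J) x0 1 - xs =
  (x0 - xs) - row_proj (J 0) *m (x0 - xs).
Proof.
have -> : block_kaczmarz A b (S \o J) x0 1 =
    x0 - row_proj (J 0) *m x0 + row_proj (J 0) *m xs.
  by rewrite /= /row_proj -hxs mulmxBl mul1mx !mulmxA.
rewrite mulmxBr opprB -addrA addrACA [RHS]addrACA.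
by congr (_ + _); rewrite addrC.
Qed.

Lemma eq_block_kaczmarz (J J' : nat -> 'I_N) x0 k :
  (forall j, (j < k)%N -> J j = J' j) ->
  block_kaczmarz A b (S \o J) x0 k = block_kaczmarz A b (S \o J') x0 k.
Proof.
elim: k => //= k IH JJ'; rewrite JJ'// IH// => j jk.
by rewrite JJ'// ltnW.
Qed.

Variable rho : R.
Hypothesis rho0 : 0 <= rho.
Hypothesis contraction : forall e : 'cV[R]_n,
  \sum_i sqnorm (e - row_proj i *m e) <= N%:R * rho * sqnorm e.

(** Summing over all index sequences of length [k] is averaging over the
    uniform choices, up to the factor [N ^ k]. *)
Lemma sum_block_kaczmarz (i0 : 'I_N) x0 k :
  \sum_(t : k.-tuple 'I_N)
      sqnorm (block_kaczmarz A b (S \o nth i0 t) x0 k - xs) <=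
    (N%:R * rho) ^+ k * sqnorm (x0 - xs).
Proof.
elim: k x0 => [|k IH] x0.
  rewrite (eq_bigr (fun=> sqnorm (x0 - xs))) => [|t _]; last by [].
  by rewrite sumr_const card_tuple expr0 mul1r.
rewrite big_tuple_cons.
pose x1 i := block_kaczmarz A b (S \o (fun=> i)) x0 1.
apply: (@le_trans _ _ (\sum_i (N%:R * rho) ^+ k * sqnorm (x1 i - xs))).
  apply: ler_sum => i _; apply: le_trans (IH (x1 i)).
  by apply: ler_sum => t _; rewrite block_kaczmarz_front.
rewrite -mulr_sumr exprSr -mulrA ler_wpM2l ?exprn_ge0 ?mulr_ge0//.
apply: le_trans (contraction (x0 - xs)); apply: ler_sum => i _.
by rewrite block_kaczmarz_error.
Qed.

Lemma expectation_block_kaczmarz d' (T' : measurableType d')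
    (P' : probability T' R) (idx : nat -> T' -> 'I_N) x0 k :
  (0 < N)%N -> is_uniform_choice P' idx ->
  ('E_P'[ (fun w' => norm2 (block_kaczmarz A b (fun j => S (idx j w')) x0 k
                            - xs) ^+ 2)%R ]
    <= (rho ^+ k * norm2 (x0 - xs) ^+ 2)%R%:E)%E.
Proof.
move=> N0 [mi Pi indi]; pose i0 : 'I_N := Ordinal N0.
pose Z w' : k.-tuple 'I_N := [tuple idx j w' | j < k].
pose g (t : k.-tuple 'I_N) :=
  sqnorm (block_kaczmarz A b (S \o nth i0 t) x0 k - xs).
have gE w' : norm2 (block_kaczmarz A b (fun j => S (idx j w')) x0 k - xs) ^+ 2 =
    g (Z w').
  rewrite norm2_sqr /g -[fun j => _]/(S \o (idx ^~ w')).
  congr (sqnorm (_ - _)); apply: eq_block_kaczmarz => j jk.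
  exact: esym (nth_mktuple (fun j : 'I_k => idx j w') i0 (Ordinal jk)).
pose C (j : 'I_k) := [set idx j @^-1` B | B in [set: set 'I_N]].
have iC : independent_classes P' C.
  apply: (independent_classes_sub (h := fun j : 'I_k => nat_of_ord j) _ _ indi).
    exact: ord_inj.
  by move=> j.
have ZE t : Z @^-1` [set t] = \bigcap_(j : 'I_k) (idx j @^-1` [set tnth t j]).
  apply/seteqP; split=> w /=; first by move=> <- j _; rewrite tnth_mktuple.
  by move=> Zt; apply: eq_from_tnth => j; rewrite tnth_mktuple; exact: Zt.
have mZ t : measurable (Z @^-1` [set t]).
  by rewrite ZE; apply: fin_bigcap_measurable => // j _; exact: mi.
have PZ t : fine (P' (Z @^-1` [set t])) = N%:R^-1 ^+ k.
  rewrite ZE (independent_classes_fin iC); last first.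
    by move=> j; exists [set tnth t j].
  transitivity (fine (\prod_(j < k) (N%:R^-1 : R)%:E)%E).
    by congr fine; apply: eq_bigr => j _; exact: Pi.
  by rewrite prodEFin/= prodr_const card_ord.
rewrite unlock; under eq_integral do rewrite gE.
rewrite (integral_finite_valued P' g mZ) lee_fin.
under eq_bigr do rewrite PZ.
have NR : 0 < N%:R :> R by rewrite ltr0n.
rewrite -mulr_suml exprVn ler_pdivrMr ?exprn_gt0// norm2_sqr.
by rewrite mulrAC -exprMn (mulrC rho) sum_block_kaczmarz.
Qed.

End MeanError.

(** * The good event *)

Lemma union_bound d (T : measurableType d) (R : realType) (P : probability T R)
    (I : finType) (A : I -> set T) : (forall i, measurable (A i)) ->
  measurable (\bigcup_i A i) /\ (P (\bigcup_i A i) <= \sum_i P (A i))%E.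
Proof.
move=> mA; have mU : measurable (\bigcup_i A i) by exact: fin_bigcup_measurable.
split=> //; rewrite fsbig_seq ?index_enum_uniq//.
apply: content_sub_fsum => //.
by move=> w [i _ Aw]; exists i => //=; rewrite mem_index_enum.
Qed.

Section GoodEvent.
Context d (T : measurableType d) (R : realType) (P : probability T R).
Variables (N m s : nat) (S : 'I_N -> T -> 'M[R]_(m, s)).
Hypothesis gS : is_gaussian_collection P S.
Hypothesis m0 : (0 < m)%N.

Let mS i : measurable_mx (S i).
Proof. exact: std_gaussian_measurable (gS.1 i). Qed.

Let sigma_mx_measurable i : sigma_mx (S i) `<=` measurable.
Proof.
apply: smallest_sub; first exact: sigma_algebra_measurable.
by move=> C [p _]; apply: sigma_rv_measurable; exact: mS.
Qed.

Let sigma_mx_range_proj i (u : 'cV[R]_m) B : measurable B ->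
  sigma_mx (S i) ((fun w => dotv u (range_proj (S i w) *m u)) @^-1` B).
Proof.
move=> mB; pose T' := g_sigma_algebraType
  (\bigcup_(pq in [set: 'I_m * 'I_s]) sigma_rv (fun w => S i w pq.1 pq.2)).
have mST' : @measurable_mx _ T' R _ _ (S i).
  move=> p q _ C mC; apply: sub_sigma_algebra; exists (p, q) => //.
  by exists C.
have mQ := measurable_range_proj mST'.
have mu : @measurable_mx _ T' R _ _ (fun=> u) by exact: measurable_mx_cst.
have mf := measurable_dotv mu (measurable_mx_mul mQ mu).
by have := mf measurableT B mB; rewrite setTI.
Qed.

(** The threshold is a quarter of the mean [N s / m], so that the Chernoff
    exponent [t - N mu / 2] becomes [- N s / (4 m)]. *)
Lemma range_proj_lower_tail (u : 'cV[R]_m) : (s <= m)%N ->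
  (P [set w | (\sum_i sqnorm (range_proj (S i w) *m u) <
      N%:R * s%:R / (4 * m%:R) * sqnorm u)%R] <=
    (expR (- (N%:R * s%:R / (4 * m%:R))))%:E)%E.
Proof.
move=> sm; have [->|u0] := eqVneq u 0.
  rewrite (_ : [set w | _] = set0) ?measure0 ?lee_fin ?expR_ge0//.
  apply/seteqP; split=> w //=; rewrite sqnorm0 mulr0 big1 ?ltxx// => i _.
  by rewrite mulmx0 sqnorm0.
have u1 : 0 < sqnorm u by rewrite sqnorm_gt0.
pose v := (Num.sqrt (sqnorm u))^-1 *: u.
have v1 : sqnorm v = 1.
  by rewrite sqnormZ exprVn sqr_sqrtr ?(ltW u1)// mulVf ?gt_eqF.
pose Y i w := dotv v (range_proj (S i w) *m v).
have YE i w : Y i w = sqnorm (range_proj (S i w) *m v).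
  by rewrite /Y dotv_projector ?range_proj_tr ?range_proj_idem.
have Yu i w : Y i w = sqnorm (range_proj (S i w) *m u) / sqnorm u.
  by rewrite YE -scalemxAr sqnormZ exprVn sqr_sqrtr ?(ltW u1)// mulrC.
set t := N%:R * s%:R / (4 * m%:R).
rewrite (_ : [set w | _] = [set w | \sum_i Y i w < t]); last first.
  apply/seteqP; split=> w /=;
    by rewrite (eq_bigr _ (fun i _ => Yu i w)) -mulr_suml ltr_pdivrMr.
have mR : 0 < m%:R :> R by rewrite ltr0n.
have -> : - t = t - N%:R * (s%:R / m%:R) / 2.
  by rewrite /t; field; rewrite gt_eqF.
apply: (chernoff_lower t gS.2) => //.
- by move=> i B mB; exact: sigma_mx_range_proj.
- move=> i w; rewrite YE sqnorm_ge0 -v1 /=.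
  by rewrite sqnorm_projector_le ?range_proj_tr ?range_proj_idem.
- by move=> i; rewrite (mean_range_proj (gS.1 i))// v1 mulr1.
Qed.

Lemma range_proj_grid_event K : (0 < K)%N -> (s <= m)%N ->
  exists E : set T, [/\ measurable E,
    ((1 - ((2 * K).+1 ^ m)%:R * expR (- (N%:R * s%:R / (4 * m%:R))))%:E
       <= P E)%E &
    forall w, E w -> forall g : {ffun 'I_m -> 'I_(2 * K).+1},
      N%:R * s%:R / (4 * m%:R) * sqnorm (grid_point R g) <=
        \sum_i sqnorm (range_proj (S i w) *m grid_point R g)].
Proof.
move=> K0 sm; set t := N%:R * s%:R / (4 * m%:R).
pose G := {ffun 'I_m -> 'I_(2 * K).+1}.
pose bad (g : G) := [set w |
  \sum_i sqnorm (range_proj (S i w) *m grid_point R g)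
    < t * sqnorm (grid_point R g)].
have mbad g : measurable (bad g).
  pose f w :=
    \sum_i dotv (grid_point R g) (range_proj (S i w) *m grid_point R g).
  have mf : measurable_fun setT f.
    apply: measurable_sum => i _ B mB; rewrite setTI.
    by apply: sigma_mx_measurable; exact: sigma_mx_range_proj.
  have := mf measurableT `]-oo, t * sqnorm (grid_point R g)[%classic
    (measurable_itv _).
  rewrite setTI; congr measurable.
  apply/seteqP; split=> w /=; rewrite in_itv/= /f;
  by under eq_bigr do rewrite dotv_projector ?range_proj_tr ?range_proj_idem//.
have [mU PU] := union_bound P mbad.
exists (~` \bigcup_g bad g); split; first exact: measurableC.
  have {}PU : (P (\bigcup_g bad g) <= (((2 * K).+1 ^ m)%:R * expR (- t))%:E)%E.
    apply: le_trans PU _.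
    apply: le_trans (_ : (\sum_(g : G) (expR (- t))%:E <= _)%E).
      by apply: lee_sum => g _; exact: range_proj_lower_tail.
    by rewrite sumEFin sumr_const card_ffun !card_ord mulr_natl.
  by rewrite probability_setC// EFinB; apply: leeB.
move=> w h g; rewrite leNgt; apply/negP => bg; apply: h; by exists g.
Qed.

End GoodEvent.

(** * From the projectors to the rate of convergence *)

Section Assembly.
Variable R : realType.

(** The bound on the range projectors is applied to [y = A e]: the largest
    singular value enters through [range_proj_le_pinv] and the smallest one
    through [|A e| >= sigma_min |e|]. *)
Lemma mean_contraction (m n s N : nat) (A : 'M[R]_(m, n))
    (S : 'I_N -> 'M[R]_(m, s)) (l : R) (e : 'cV[R]_n) : \rank A = n -> 0 <= l ->
  (forall y, N%:R * l * sqnorm y <= \sum_i sqnorm (range_proj (S i) *m y)) ->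
  \sum_i sqnorm (e - row_proj A S i *m e) <=
    N%:R * (1 - l / kappa2 A) * sqnorm e.
Proof.
move=> rA l0 lb; have [->|e0] := eqVneq e 0.
  rewrite big1 ?sqnorm0 ?mulr0// => i _.
  by rewrite mulmx0 subr0 sqnorm0.
have e1 : 0 < sqnorm e by rewrite sqnorm_gt0.
set M := sigma_max A ^+ 2; set a := sigma_min A ^+ 2.
have M0 : 0 < M.
  have := sqnorm_mul_le e rA; rewrite -/M.
  move=> /(lt_le_trans (full_rank_sqnorm_gt0 rA e0)).
  by rewrite pmulr_lgt0.
have key : N%:R * (l / kappa2 A) * sqnorm e <=
    \sum_i sqnorm (row_proj A S i *m e).
  have -> : N%:R * (l / kappa2 A) * sqnorm e = N%:R * l * (a * sqnorm e) / M.
    by rewrite /kappa2 -/M -/a invf_div; field; rewrite gt_eqF.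
  rewrite ler_pdivrMr// mulr_suml.
  apply: le_trans (_ : N%:R * l * sqnorm (A *m e) <= _).
    by rewrite ler_wpM2l ?mulr_ge0// sqnorm_mul_ge.
  apply: le_trans (lb _) _; apply: ler_sum => i _; rewrite mulrC.
  exact: range_proj_le_pinv.
rewrite (eq_bigr (fun i => sqnorm e - sqnorm (row_proj A S i *m e)));
  last first.
  by move=> i _; rewrite sqnorm_projectorC ?pinv_proj_tr ?pinv_proj_idem.
rewrite sumrB sumr_const card_ord -[X in X - _]mulr_natl.
rewrite mulrBr mulr1 mulrBl lerB//.
Qed.

(** The number of grid points is at most [m ^ (6 m)], while the exponent of the
    tail is at least [16 c m ln m]. *)
Lemma grid_union_small (m s N : nat) (c : R) :
  (1 < m)%N -> (0 < s)%N -> 3 < c ->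
  64 * c * m%:R ^+ 2 * ln m%:R <= N%:R ->
  ((2 * (8 * m)).+1 ^ m)%:R * expR (- (N%:R * s%:R / (4 * m%:R))) <=
    (m%:R : R) `^ (3 - c).
Proof.
move=> m1 s0 hc hN.
have mR : 0 < m%:R :> R by rewrite ltr0n (ltn_trans _ m1).
have l0 : 0 < ln m%:R :> R by rewrite ln_gt0// ltr1n.
have count : ((2 * (8 * m)).+1 ^ m)%:R <= expR ((6 * m)%:R * ln (m%:R : R)).
  rewrite expRM_natl lnK ?posrE// -natrX ler_nat expnM.
  rewrite leq_exp2r ?(ltn_trans _ m1)//.
  have : (2 ^ 5 <= m ^ 5)%N by rewrite leq_exp2r.
  rewrite (expnS m 5); nia.
apply: le_trans (ler_wpM2r (expR_ge0 _) count) _.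
rewrite -expRD /powR gt_eqF// ler_expR.
have tail : 16 * c * m%:R * ln m%:R <= N%:R * s%:R / (4 * m%:R).
  rewrite ler_pdivlMr ?mulr_gt0//.
  have -> : 16 * c * m%:R * ln m%:R * (4 * m%:R) =
      64 * c * m%:R ^+ 2 * ln m%:R by ring.
  by apply: le_trans hN _; rewrite ler_peMr ?ler1n.
have m2 : 2 <= m%:R :> R by rewrite ler_nat.
have -> : (6 * m)%:R = 6 * m%:R :> R by rewrite natrM.
have : 6 * m%:R - 16 * c * m%:R <= 3 - c by nra.
move=> /(ler_wpM2r (ltW l0)) h; apply: le_trans h.
rewrite mulrBl; lra.
Qed.

End Assembly.

Theorem theorem2p4 (R : realType) (m n s N : nat) (c : R)
    (A : 'M[R]_(m, n)) (b : 'cV[R]_m) (xs : 'cV[R]_n)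
    (d : measure_display) (T : measurableType d) (P : probability T R)
    (S : 'I_N -> T -> 'M[R]_(m, s))
    (hmn : (n <= m)%N)
    (hA : \rank A = n)
    (hxs : A *m xs = b)
    (hs : (0 < s)%N)
    (hrate : 0 <= 1 - s%:R / (36 * m%:R * kappa2 A))
    (hc : 3 < c)
    (hN1 : 64 * c * m%:R ^+ 2 * ln m%:R <= N%:R)
    (hN2 : N%:R <= expR (m%:R / 3 : R))
    (hS : is_gaussian_collection P S) :
  exists2 E : set T,
    measurable E /\ ((1 - 11 / 10 * m%:R `^ (3 - c))%R%:E <= P E)%E &
    forall w, E w ->
      forall (x0 : 'cV[R]_n)
             (d' : measure_display) (T' : measurableType d')
             (P' : probability T' R) (idx : nat -> T' -> 'I_N),
        is_uniform_choice P' idx ->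
        forall k : nat,
          ('E_P'[ (fun w' => norm2 (block_kaczmarz A b
                                      (fun j => S (idx j w') w) x0 k - xs) ^+ 2)%R ]
           <= ((1 - s%:R / (36 * m%:R * kappa2 A)) ^+ k
               * norm2 (x0 - xs) ^+ 2)%R%:E)%E.
Proof.
have p0 : 0 <= m%:R `^ (3 - c) by exact: powR_ge0.
have [n0|n0] := posnP n.
  subst n; have z (x : 'cV[R]_0) : norm2 x ^+ 2 = 0.
    by rewrite (flatmx0 x) norm2_sqr sqnorm0.
  exists setT; first by split=> //; rewrite probability_setT lee_fin; lra.
  move=> w _ x0 d' T' P' idx _ k; rewrite z mulr0 unlock.
  by under eq_integral do rewrite z; rewrite integral0.
have m0 : (0 < m)%N by exact: leq_trans n0 hmn.
have [m1|m1] := leqP m 1.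
  (* For m = 1 the prescribed probability is 1 - 11 / 10 < 0. *)
  exists set0 => //; split=> //; rewrite measure0 lee_fin.
  have -> : m = 1%N by apply/eqP; rewrite eqn_leq m1 m0.
  by rewrite powR1; lra.
have N0 : (0 < N)%N.
  rewrite -(ltr0n R) (lt_le_trans _ hN1)// !mulr_gt0 ?exprn_gt0 ?ltr0n//.
    by rewrite (lt_trans _ hc).
  by rewrite ln_gt0// ltr1n.
have mR : 0 < m%:R :> R by rewrite ltr0n.
have rateE : s%:R / (36 * m%:R * kappa2 A) = s%:R / (36 * m%:R) / kappa2 A.
  by rewrite invfM mulrA.
have [sm|ms] := leqP s m; last first.
  (* The square block formed by the first m columns decides injectivity. *)
  pose g := widen_ord (ltnW ms).
  pose bad i := [set w | \det (colsub g (S i w)) = 0].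
  have gI : injective g by move=> i j /(congr1 val) /= /val_inj.
  have gX i : is_std_gaussian_mx P (fun w => colsub g (S i w)).
    have := std_gaussian_reindex (fun=> false) (@inj_id 'I_m) gI (hS.1 i).
    congr (is_std_gaussian_mx P _); apply/funext => w; apply/matrixP => p q.
    by rewrite !mxE expr0 mul1r.
  have mbad i : measurable (bad i).
    have := measurable_mx_det (std_gaussian_measurable (gX i)) measurableT
      (measurable_set1 0).
    by rewrite setTI.
  have [mU PU] := union_bound P mbad.
  exists (~` \bigcup_i bad i).
    split; first exact: measurableC.
    have PU0 : P (\bigcup_i bad i) = 0%E.
      apply/eqP; rewrite eq_le measure_ge0 andbT (le_trans PU)//.
      by rewrite big1// => i _; exact: std_gaussian_det_neq0.
    rewrite probability_setC//.
    rewrite [X in (_ - X)%E]PU0 sube0 lee_fin; lra.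
  move=> w good x0 d' T' P' idx hidx k.
  apply: (expectation_block_kaczmarz hxs (S := S ^~ w) hrate) => // e.
  rewrite big1; first by rewrite mulr_ge0 ?sqnorm_ge0// mulr_ge0.
  move=> i _; rewrite /row_proj (pinv_proj_full (g := g))//.
    by rewrite mul1mx subrr sqnorm0.
  by apply/eqP => bi; apply: good; exists i.
(* With mesh 1 / (8 m) a grid point at Euclidean distance |u - y| satisfies
   |u - y|^2 <= m / (8 m)^2 = 1 / (64 m).  The error N / (64 m) thus leaves
   enough of the main term N s / (16 m) to stay above N s / (36 m). *)
have K0 : (0 < 8 * m)%N by rewrite muln_gt0.
have [E [mE PE good]] := range_proj_grid_event hS m0 K0 sm.
exists E.
  split=> //; apply: le_trans PE; rewrite lee_fin lerB//.
  by apply: le_trans (grid_union_small m1 hs hc hN1) _; lra.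
move=> w Ew x0 d' T' P' idx hidx k.
apply: (expectation_block_kaczmarz hxs (S := S ^~ w) hrate) => // e.
rewrite rateE; apply: mean_contraction => // y.
have tau0 : 0 <= N%:R * s%:R / (4 * m%:R) :> R.
  by rewrite divr_ge0 ?mulr_ge0// ltW.
have := grid_lower_bound K0 tau0 (fun i => range_proj_tr (S i w))
  (fun i => range_proj_idem (S i w)) (good w Ew) y.
apply: le_trans; rewrite ler_wpM2r ?sqnorm_ge0//.
have s1 : 1 <= s%:R :> R by rewrite ler1n.
have m2 : 2 <= m%:R :> R by rewrite ler_nat.
have -> : m%:R / (8 * m)%:R ^+ 2 = (64 * m%:R)^-1 :> R.
  by rewrite natrM; field; rewrite gt_eqF.
rewrite -subr_ge0.
have -> : N%:R * s%:R / (4 * m%:R) * (1 / 2 - (64 * m%:R)^-1) / 2 -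
    N%:R * (64 * m%:R)^-1 - N%:R * (s%:R / (36 * m%:R)) =
  N%:R * (s%:R * m%:R / 16 - s%:R / 512 - m%:R / 64 - s%:R * m%:R / 36)
    / m%:R ^+ 2 :> R.
  by field; rewrite gt_eqF.
have sm1 : m%:R <= s%:R * m%:R :> R by rewrite ler_peMl// ltW.
have sm2 : s%:R * 2 <= s%:R * m%:R :> R by rewrite ler_wpM2l.
apply: divr_ge0; last exact: sqr_ge0.
apply: mulr_ge0; first exact: ler0n.
lra.
Qed.
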